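(* The following are equivalent for a countable ring $R$: (1) there exists an uncountable free $R$-module admitting a Polish $R$-module topology; (2) the ring $R$ is right coherent and left perfect; (3) the class of projective $R$-modules is closed under (arbitrary) direct products; (4) $({}_RR)^{\omega}\cong({}_RR)^{(\mathfrak c)}$, a free $R$-module.
   Context: Rings have an identity $1\neq 0$; modules are unital left modules unless stated otherwise; $R$ is given the discrete topology. $M^J$ is the direct product and $M^{(J)}$ the direct sum of $J$ copies of $M$; $\mathfrak c=2^{\aleph_0}$. A Polish $R$-module topology on an $R$-module $A$ is a separable completely metrizable topology for which $(A,+,-,0)$ is a topological group and scalar multiplication $R\times A\to A$ is continuous. $R$ is right coherent if every finitely generated right ideal is finitely presented. $R$ is left perfect if every left $R$-module has a projective cover (equivalently, every descending chain of principal right ideals stabilizes). *)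

(* Defs.v *)
From HB Require Import structures.
From mathcomp Require Import all_boot all_order all_algebra.
From mathcomp Require Import all_classical all_reals all_analysis.

Set Implicit Arguments.
Unset Strict Implicit.
Unset Printing Implicit Defensive.

Import GRing.Theory.

Local Open Scope classical_set_scope.
Local Open Scope ring_scope.

(* A new type, so that these instances do not overlap with those that
   functions.v declares on non-dependent function types. *)
Definition dprod (R : nzRingType) (I : Type) (M : I -> lmodType R) : Type :=
  forall i, M i.

Section DirectProduct.
Variables (R : nzRingType) (I : Type) (M : I -> lmodType R).
Implicit Types f g h : dprod M.

HB.instance Definition _ := Choice.copy (dprod M) (forall i, M i).

Definition dprod_add f g : dprod M := fun i => f i + g i.
Definition dprod_opp f : dprod M := fun i => - f i.
Definition dprod_scale (a : R) f : dprod M := fun i => a *: f i.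

Fact dprod_addA : associative dprod_add.
Proof. by move=> f g h; apply: functional_extensionality_dep => i; exact: addrA. Qed.

Fact dprod_addC : commutative dprod_add.
Proof. by move=> f g; apply: functional_extensionality_dep => i; exact: addrC. Qed.

Fact dprod_add0 : left_id ((fun=> 0) : dprod M) dprod_add.
Proof. by move=> f; apply: functional_extensionality_dep => i; exact: add0r. Qed.

Fact dprod_addN : left_inverse ((fun=> 0) : dprod M) dprod_opp dprod_add.
Proof. by move=> f; apply: functional_extensionality_dep => i; exact: addNr. Qed.

HB.instance Definition _ := GRing.isZmodule.Build (dprod M)
  dprod_addA dprod_addC dprod_add0 dprod_addN.

Fact dprod_scaleA (a b : R) f :
  dprod_scale a (dprod_scale b f) = dprod_scale (a * b) f.
Proof. by apply: functional_extensionality_dep => i; exact: scalerA. Qed.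

Fact dprod_scale1 : left_id 1 dprod_scale.
Proof. by move=> f; apply: functional_extensionality_dep => i; exact: scale1r. Qed.

Fact dprod_scaleDr : right_distributive dprod_scale +%R.
Proof. by move=> a f g; apply: functional_extensionality_dep => i; exact: scalerDr. Qed.

Fact dprod_scaleDl f : {morph dprod_scale^~ f : a b / a + b}.
Proof. by move=> a b; apply: functional_extensionality_dep => i; exact: scalerDl. Qed.

HB.instance Definition _ := GRing.Zmodule_isLmodule.Build R (dprod M)
  dprod_scaleA dprod_scale1 dprod_scaleDr dprod_scaleDl.

End DirectProduct.

Section Submodule.
Variables (R : nzRingType) (V : lmodType R).

(* The module underlying a submodule S of V, as submodClosed only provides
   the predicate on V. *)
Definition submod (S : submodClosed V) : Type := {x : V | x \in S}.

HB.instance Definition _ (S : submodClosed V) := SubChoice.on (submod S).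
HB.instance Definition _ (S : submodClosed V) :=
  [SubChoice_isSubLmodule of submod S by <:].

End Submodule.

Section DirectSum.
Variables (R : nzRingType) (I : Type) (M : I -> lmodType R).

Definition fin_supp : {pred dprod M} :=
  fun f => `[< finite_set [set i | f i <> 0] >].

Fact fin_supp_submod : submod_closed fin_supp.
Proof.
split=> [|a f g /asboolP ff /asboolP gf]; apply/asboolP.
  by rewrite (_ : mkset _ = set0) // -subset0 => i /=.
have fgf : finite_set ([set i | f i <> 0] `|` [set i | g i <> 0]).
  by rewrite finite_setU.
apply: sub_finite_set fgf => i /= fgi.
have [fi0|] := pselect (f i = 0); last by left.
right=> gi0; apply: fgi.
by rewrite -[LHS]/(a *: f i + g i) fi0 gi0 scaler0 addr0.
Qed.

HB.instance Definition _ :=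
  GRing.isSubmodClosed.Build R (dprod M) fin_supp fin_supp_submod.

Definition dsum : Type := submod fin_supp.

HB.instance Definition _ := GRing.Lmodule.on dsum.

End DirectSum.

Definition direct_power (R : nzRingType) (J : Type) (M : lmodType R) :
  lmodType R := dprod (fun _ : J => M).

Definition direct_copower (R : nzRingType) (J : Type) (M : lmodType R) :
  lmodType R := dsum (fun _ : J => M).

Section Modules.
Variable R : nzRingType.

Definition isomorphic (M N : lmodType R) :=
  exists f : {linear M -> N}, bijective f.

Definition free_module (M : lmodType R) :=
  exists J : Type, isomorphic M (direct_copower J R^o).

Definition projective (P : lmodType R) :=
  forall (M N : lmodType R) (g : {linear M -> N}) (f : {linear P -> N}),
    set_surj setT setT g -> exists h : {linear P -> M}, forall x, g (h x) = f x.

Definition superfluous (P : lmodType R) (K : set P) :=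
  forall N : submodClosed P,
    (forall x : P, exists2 n, n \in N & exists2 k, K k & x = n + k) ->
    forall x : P, x \in N.

Definition has_projective_cover (M : lmodType R) :=
  exists (P : lmodType R) (p : {linear P -> M}),
    [/\ projective P, set_surj setT setT p & superfluous [set x | p x = 0]].

Definition left_perfect := forall M : lmodType R, has_projective_cover M.

Definition fin_generated (M : lmodType R) (S : set M) :=
  exists (n : nat) (x : 'I_n -> M),
    S = [set m | exists a : 'I_n -> R, m = \sum_(i < n) a i *: x i].

Definition fin_presented (M : lmodType R) :=
  exists (n : nat) (f : {linear 'rV[R]_n -> M}),
    set_surj setT setT f /\ fin_generated [set v | f v = 0].

Definition left_coherent :=
  forall I : submodClosed R^o, fin_generated [set` I] -> fin_presented (submod I).

End Modules.

(* Right R-modules are left modules over the converse ring R^c. *)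
Definition right_coherent (R : nzRingType) := left_coherent R^c.

(* Topological.axioms_ A and Metric.axioms_ K T are the HB classes of
   topological, resp. metric, structures on the given carrier, so quantifying
   over them quantifies over the topologies on A, resp. the metrics on T. *)
Section Polish.
Variable K : realType.

Definition separable_space (T : topologicalType) :=
  exists2 D : set T, countable D & dense D.

Definition completely_metrizable (T : topologicalType) :=
  exists m : Metric.axioms_ K T, let X : metricType K := Metric.Pack m in
    (forall x : T, nbhs (x : X) = nbhs x) /\
    (forall F : set_system X, ProperFilter F -> cauchy F ->
       exists x : X, F --> x).

(* The scalar ring carries the discrete topology. *)
Definition is_polish_module_topology (R : nzRingType) (A : lmodType R)
    (t : Topological.axioms_ A) :=
  let T : topologicalType := Topological.Pack t in
  [/\ separable_space T,
      completely_metrizable T,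
      continuous (fun p : T * T => (p.1 : A) + p.2 : T),
      continuous (fun x : T => - (x : A) : T)
    & continuous (fun p : discrete_topology R * T => (p.1 : R) *: (p.2 : A) : T)].

Definition admits_polish_module_topology (R : nzRingType) (A : lmodType R) :=
  exists t : Topological.axioms_ A, is_polish_module_topology t.

End Polish.

(* Main.v *)
Require Import Defs.
From HB Require Import structures.
From mathcomp Require Import all_boot all_order all_algebra.
From mathcomp Require Import all_classical all_reals all_analysis.

Set Implicit Arguments.
Unset Strict Implicit.
Unset Printing Implicit Defensive.

Import Order.TTheory GRing.Theory Num.Theory.

Local Open Scope classical_set_scope.
Local Open Scope ring_scope.

(** The proof runs around the cycle of implications.  A Polish topology yields
    left perfectness through the descending chain condition on principal right
    ideals, and right coherence through Baire category.

    From a Polish topology to algebra.  A Polish abelian group A carries a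
    sequence of symmetric neighbourhoods V_n of 0 with V_(n+1) + V_(n+1)
    inside V_n such that every series whose n-th term lies in V_n converges
    ([klee]); all later arguments only use such a filtration.  Suppose that
    x_0 R > x_1 R > ... is strictly descending, with x_(n+1) = x_n a_n, and
    that A is embedded as a direct summand in a free module.  Separability
    makes every V_n so large that one can choose t_n in it, small against all
    the products of the a_k that will multiply it, for which x_n t_n has a
    coordinate outside x_(n+1) R at a place where t_0, ..., t_(n-1) all
    vanish.  The sum of the x_n t_n then converges to an element with
    infinitely many nonzero coordinates, which is absurd
    ([filtered_right_dcc]).  This applies to an uncountable free module and
    to the module of all sequences of scalars, when the latter is projective.
    Coherence is a Baire category argument: the vectors of A^n killed by a row
    b form a Polish group, the increasing union of countably many images of
    powers of A, so one of these images contains a neighbourhood of 0 by the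
    open mapping theorem, and reading off one coordinate shows that the
    corresponding finitely many syzygies of b generate all of them
    ([filtered_syzygies]).

    From the chain condition to projective covers (Bass).  The chain condition
    makes the Jacobson radical J left T-nilpotent, whence Nakayama's lemma
    holds for arbitrary modules, and it provides idempotents f for which
    R f / J f is simple and whose right ideals f R, together with J, span R.
    Hence M / J M is a sum of tops of the modules R f, and a maximal independent
    family of such tops lifts to a projective cover of M
    ([right_dcc_left_perfect]).

    From perfectness to products.  When projective covers exist, flat modules
    are projective: the kernel of a cover of a flat module is both pure and
    superfluous, hence zero ([flat_projective]).  Over a right coherent ring
    the equational criterion of flatness may be checked factor by factor, so
    products of projective modules are flat ([dprod_flat]).

    From projectivity of products to the isomorphism.  The characteristic
    functions of the branches of the binary tree span a free submodule of rank
    2^omega in R^omega which locally splits off; the quotient is flat, hence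
    projective, so this free module is a direct summand.  Conversely R^omega
    is projective with 2^omega generators, hence a summand of the same free
    module, and an Eilenberg swindle gives the isomorphism ([absorption],
    [power_free]).  The cycle closes with the product topology on R^omega. *)

(** * The descending chain condition on principal right ideals *)

Section RightChain.
Variable R : nzRingType.
Implicit Types a b e f r s x y : R.

(** The chain is presented by its generators x_n together with the multipliers
    a_n that witness the inclusions. *)
Definition right_dcc := forall x a : nat -> R,
  (forall n, x n.+1 = x n * a n) -> exists n r, x n = x n.+1 * r.

(** The Jacobson radical, described elementwise. *)
Definition jacobson : set R := [set a | forall r, exists s, (1 - a * r) * s = 1].

Lemma jacobson0 : jacobson 0.
Proof. by move=> r; exists 1; rewrite mul0r subr0 mulr1. Qed.

Lemma jacobsonMr a r : jacobson a -> jacobson (a * r).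
Proof. by move=> Ja s; have [t et] := Ja (r * s); exists t; rewrite -mulrA. Qed.

(** If s is a right inverse of 1 - a r b, then 1 + b s a r is one of
    1 - b a r; this makes the radical two-sided. *)
Lemma jacobsonMl b a : jacobson a -> jacobson (b * a).
Proof.
move=> Ja r; have [s e1] := Ja (r * b); exists (1 + b * s * a * r).
have {}e1 : s - a * r * b * s = 1 by rewrite -e1 mulrBl mul1r !mulrA.
rewrite mulrDr mulr1 mulrBl mul1r.
have -> : b * a * r * (b * s * a * r) = b * (a * r * b * s) * a * r.
  by rewrite !mulrA.
by rewrite -!mulrBl -mulrBr e1 mulr1 subrK.
Qed.

Lemma jacobsonD a b : jacobson a -> jacobson b -> jacobson (a + b).
Proof.
move=> Ja Jb r; have [s es] := Ja r; have [t et] := Jb (r * s).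
exists (s * t); rewrite mulrA -[RHS]et; congr (_ * _).
by rewrite [(a + b) * r]mulrDl opprD addrA mulrBl es !mulrA.
Qed.

Lemma jacobsonN a : jacobson a -> jacobson (- a).
Proof. by move=> Ja; rewrite -mulN1r; apply: jacobsonMl. Qed.

(** (1 - a r)(1 + a r) = 1 - a r a r, so a right inverse of the right-hand
    side produces one of 1 - a r. *)
Lemma jacobson_semiprime a : (forall r, jacobson (a * r * a)) -> jacobson a.
Proof.
move=> Jaa r; have [s es] := jacobsonMr r (Jaa r) 1.
exists ((1 + a * r) * s); rewrite mulrA -[RHS]es; congr (_ * _).
by rewrite mulr1 mulrDr mulr1 mulrBl mul1r !mulrA addrA subrK.
Qed.

Hypothesis dccR : right_dcc.

(** T-nilpotence: where the chain x_n R is stationary, x_n = x_n a_n r, and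
    1 - a_n r has a right inverse. *)
Lemma jacobson_tnilp (x a : nat -> R) : (forall n, jacobson (a n)) ->
  (forall n, x n.+1 = x n * a n) -> exists n, x n = 0.
Proof.
move=> Ja xS; have [n [r e]] := dccR xS; exists n; have [s es] := Ja n r.
by rewrite -[LHS]mulr1 -es mulrA mulrBr mulr1 mulrA -xS -e subrr mul0r.
Qed.

Lemma jacobson_nil a : jacobson a -> exists n, a ^+ n = 0.
Proof. by move=> Ja; apply: (@jacobson_tnilp _ (fun=> a)) => // n; exact: exprSr. Qed.

(** The chain condition as a minimum principle for principal right ideals. *)
Lemma right_dcc_minimal (Q : set R) x0 : Q x0 ->
  exists2 x, Q x & forall r, Q (x * r) -> exists s, x = x * r * s.
Proof.
move=> Q0; apply: contrapT => noQ.
have next x : {r | Q x -> Q (x * r) /\ forall s, x <> x * r * s}.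
  apply: cid; have [Qx|] := pselect (Q x); last by exists 0.
  apply: contrapT => nor; apply: noQ; exists x => // r Qr; apply: contrapT => nos.
  by apply: nor; exists r => _; split=> // s es; apply: nos; exists s.
pose xs := fix xs n := if n is m.+1 then xs m * sval (next (xs m)) else x0.
have Qxs n : Q (xs n).
  by elim: n => //= n IH; case: (next (xs n)) => r /= /(_ IH)[].
have [n [r]] := dccR (a := fun n => sval (next (xs n))) (fun n => erefl (xs n.+1)).
by rewrite /=; case: (next (xs n)) => t /= /(_ (Qxs n))[_]; exact.
Qed.

(** The last clause says that f R is minimal among the principal right ideals
    outside the radical; these are the idempotents for which R f / J f is a
    simple left module. *)
Definition local_idempotent f :=
  [/\ f * f = f, ~ jacobson f
    & forall r, ~ jacobson (f * r) -> exists s, f = f * r * s].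

(** Minimality of f R makes f R f local: for t with r f t r f outside the
    radical, x = f t r f has a right inverse w in f R f, and w has one as well,
    so w is a two-sided inverse of x.  This carries the minimality of f R over
    to the left module R f. *)
Lemma local_idempotent_left f r : local_idempotent f ->
  ~ jacobson (r * f) -> exists s, f = s * r * f.
Proof.
move=> [ff nJf minf] nJrf.
have [t nJt] : exists t, ~ jacobson (r * f * t * (r * f)).
  apply: contrapT => not; apply/nJrf/jacobson_semiprime => t.
  by apply: contrapT => nJ; apply: not; exists t.
have nJx : ~ jacobson (f * (t * r * f)).
  by move/(jacobsonMl r); rewrite !mulrA in nJt *.
have [u eu] := minf _ nJx; set x := f * (t * r * f) in nJx eu.
have xf : x * f = x by rewrite /x -!mulrA ff.
set w := f * u * f; have xw : x * w = f by rewrite /w !mulrA xf -eu ff.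
have fw : f * w = w by rewrite /w !mulrA ff.
have nJw : ~ jacobson (f * w) by rewrite fw => /(jacobsonMl x); rewrite xw.
have [v] := minf _ nJw; rewrite fw => ev.
have wf : w * f = w by rewrite /w -!mulrA ff.
have wx : w * x = f.
  have -> : x = f * v by rewrite -[x in LHS]xf [X in x * X]ev mulrA xw.
  by rewrite mulrA wf.
by exists (w * f * t); rewrite -[LHS]wx /x !mulrA.
Qed.

(** The polynomial f = 1 - (1 - e^k)^k is divisible by e^k and 1 - f by
    (1 - e)^k; it is idempotent as soon as k kills e (1 - e). *)
Lemma idempotent_lift e : jacobson (e * e - e) -> exists n f,
  [/\ f * f = f, exists u, f = e * u & e ^+ n * f = e ^+ n].
Proof.
move=> Je; have [n en0] := jacobson_nil Je.
have ce : GRing.comm e (1 - e) by apply: commrB; [exact: commr1|].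
have ek0 : e ^+ n.+1 * (1 - e) ^+ n.+1 = 0.
  rewrite -exprMn_comm // mulrBr mulr1 -opprB exprNn.
  by rewrite [X in _ * X]exprS en0 !mulr0.
set k := n.+1 in ek0; pose z := e ^+ k; pose f := 1 - (1 - z) ^+ k.
have fE : f = z * \sum_(i < k) (1 - z) ^+ i.
  by rewrite /f -opprB subrX1 -mulNr opprB opprB addrC subrK.
have zf0 : z * (1 - f) = 0.
  rewrite /f opprB addrC subrK -(opprB z 1) /z subrX1 -mulNr opprB exprMn_comm.
    by rewrite mulrA ek0 mul0r.
  apply: commr_sum => i _; apply: commrX; apply: commr_sym.
  by apply: commrB; [exact: commr1|].
have zf : z * f = z by apply/esym/eqP; rewrite -subr_eq0 -[X in X - _]mulr1 -mulrBr zf0.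
have fz : f * z = z.
  rewrite -[RHS]zf; apply/commr_sym; apply: commrB; first exact: commr1.
  by apply: commrX; apply: commrB; [exact: commr1|].
exists k, f; split=> //; first by rewrite {2}fE mulrA fz -fE.
by exists (e ^+ n * \sum_(i < k) (1 - z) ^+ i); rewrite mulrA -exprS.
Qed.

(** Inside x R choose a R minimal outside the radical.  Some b = a r has b a
    outside the radical, so b R = a R and b a R = a R, which yields e in a R
    with b e = b.  If e^2 - e were outside the radical it would generate b R,
    and b (e^2 - e) = 0 would force b^2 = 0.  So e is idempotent modulo the
    radical, and it lifts. *)
Lemma ex_local_idempotent x : ~ jacobson x ->
  exists2 f, local_idempotent f & exists y, f = x * y.
Proof.
move=> nJx; pose Q z := ~ jacobson z /\ exists y, z = x * y.
have [|a [nJa [y0 aE]] mina] := @right_dcc_minimal Q x.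
  by split=> //; exists 1; rewrite mulr1.
have {}mina r : ~ jacobson (a * r) -> exists s, a = a * r * s.
  by move=> nJ; apply: mina; split=> //; exists (y0 * r); rewrite mulrA -aE.
have [r nJ] : exists r, ~ jacobson (a * r * a).
  apply: contrapT => no; apply/nJa/jacobson_semiprime => r.
  by apply: contrapT => nJ; apply: no; exists r.
set b := a * r in nJ; have nJb : ~ jacobson b.
  by move=> Jb; apply/nJ/jacobsonMr.
have [s es] := mina _ nJb.
have minb t : ~ jacobson (b * t) -> exists u, b = b * t * u.
  rewrite /b -mulrA => /mina[u eu]; exists (u * r).
  by rewrite {1}eu !mulrA.
have [t et] : exists t, a = b * a * t.
  by have [|t] := mina (r * a); rewrite mulrA //; exists t.
pose e := a * t * r; have be : b * e = b by rewrite /e /b !mulrA -/b -et.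
have eb : e = b * (s * t * r) by rewrite /e {1}es !mulrA.
have Je : jacobson (e * e - e).
  apply: contrapT => nJn; have [u eu] : exists u, e * e - e = b * u.
    by exists (s * t * r * e - s * t * r); rewrite mulrBr [b * (_ * e)]mulrA -eb.
  rewrite eu in nJn; have [w ew] := minb _ nJn.
  have bn0 : b * (e * e - e) = 0 by rewrite mulrBr mulrA !be subrr.
  have bb0 : b * b = 0 by rewrite [X in b * X]ew -eu mulrA bn0 mul0r.
  apply: nJb; rewrite -be eb mulrA bb0 mul0r; exact: jacobson0.
have [n [f [ff [u fE] ef]]] := idempotent_lift Je.
have bn : b * e ^+ n = b.
  by elim: n {ef} => [|n IH]; rewrite ?mulr1 // exprSr mulrA IH.
exists f; last by exists (y0 * (t * r * u)); rewrite fE mulrA -aE /e !mulrA.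
have fa : f = a * (t * r * u) by rewrite fE /e !mulrA.
split=> // [Jf|q]; first by apply: nJb; rewrite -bn -ef mulrA bn; exact: jacobsonMl.
rewrite {1}fa -mulrA => /mina[v ev]; exists (v * (t * r * u)).
by rewrite {1}fa {1}ev fa !mulrA.
Qed.

(** The sum of the radical and of the right ideals f R, for f a local
    idempotent. *)
Inductive local_sum : R -> Prop :=
| LocalSumJ j : jacobson j -> local_sum j
| LocalSumD f r y : local_idempotent f -> local_sum y -> local_sum (f * r + y).

(** Among the x for which 1 - x belongs to the sum, take x R minimal.  If x is
    outside the radical, f = x y is a local idempotent for some y, and
    (1 - f) x = x (1 - y x) generates a strictly smaller right ideal. *)
Lemma local_sum1 : local_sum 1.
Proof.
have sumJ y j : local_sum y -> jacobson j -> local_sum (y + j).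
  move=> Sy Jj; elim: Sy => [i Ji|f r z lf _ IH].
    by apply: LocalSumJ; exact: jacobsonD.
  by rewrite -addrA; apply: LocalSumD.
have [|x Sx minx] := @right_dcc_minimal (fun x => local_sum (1 - x)) 1.
  by rewrite subrr; apply: LocalSumJ; exact: jacobson0.
have [Jx|nJx] := pselect (jacobson x).
  by rewrite -(subrK x 1); exact: sumJ.
have [f lf [y fE]] := ex_local_idempotent nJx; case: (lf) => ff nJf _.
have [|s es] := minx (1 - y * x).
  rewrite mulrBr mulr1 mulrA -fE opprB addrCA; exact: LocalSumD.
have fx0 : f * x = 0.
  rewrite es !mulrA mulrBr mulr1.
  have -> : f * x * (y * x) = f * x by rewrite !mulrA -[f * x * y]mulrA -fE ff.
  by rewrite subrr mul0r.
by case: nJf; rewrite -ff {2}fE mulrA fx0 mul0r; exact: jacobson0.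
Qed.

End RightChain.

(** * Free modules *)

Lemma regular_scale (R : nzRingType) (a b : R) : a *: (b : R^o) = a * b.
Proof. by []. Qed.

(** A basis indexed by J, given by its coordinate functionals.  Working with an
    arbitrary module that has coordinates lets the same lemmas serve the
    direct sums of copies of R and the modules isomorphic to them. *)
Record coordinates (R : nzRingType) (J : Type) (V : lmodType R) := Coordinates {
  coef : J -> {linear V -> R^o};
  coef_inj : forall x y, (forall j, coef j x = coef j y) -> x = y;
  finite_coef : forall x, finite_set [set j | coef j x <> 0];
  ex_coef : forall f : J -> R, finite_set [set j | f j <> 0] ->
    exists x, forall j, coef j x = f j }.

Section Copower.
Variables (R : nzRingType) (J : Type).
Local Notation free := (direct_copower J R^o).

Definition copower_coef (j : J) (x : free) : R^o := sval x j.

Fact copower_coef_linear j : linear (copower_coef j). Proof. by []. Qed.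
HB.instance Definition _ j :=
  GRing.isLinear.Build R free R^o *:%R (copower_coef j) (copower_coef_linear j).

Definition copower_coordinates : coordinates J free.
Proof.
exists copower_coef => [x y e|x|f ff].
- by apply/val_inj/functional_extensionality_dep.
- by case: x => f /= /asboolP.
have Sf : (f : dprod (fun _ : J => R^o)) \in fin_supp (M := fun=> R^o).
  exact/asboolP.
by exists (exist (fun g => g \in fin_supp (M := fun=> R^o)) _ Sf).
Defined.

End Copower.

Section Basis.
Variables (R : nzRingType) (J : Type) (V : lmodType R) (B : coordinates J V).
Implicit Types (x y : V) (j : J).
Local Notation coef := (coef B).

Lemma ex_basis j : {x | forall i, coef i x = `[<i = j>]%:R}.
Proof.
apply/cid/ex_coef; apply: (sub_finite_set _ (finite_set1 (j : {classic J}))).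
by move=> i /=; case: asboolP.
Qed.

Definition basis j : V := sval (ex_basis j).

Lemma coef_basis j i : coef i (basis j) = `[<i = j>]%:R.
Proof. by rewrite /basis; case: ex_basis => x /= ->. Qed.

Lemma coef_basis_eq j : coef j (basis j) = 1.
Proof. by rewrite coef_basis; case: asboolP. Qed.

Lemma coef_basis_neq j i : i <> j -> coef i (basis j) = 0.
Proof. by rewrite coef_basis; case: asboolP. Qed.

(** Sums over a basis are computed along a duplicate-free list; [{classic J}]
    supplies the decidable equality that J itself may not have. *)
Lemma ex_support (X : set V) : finite_set X -> exists s : seq {classic J},
  uniq s /\ forall x, X x -> forall j : {classic J}, j \notin s -> coef j x = 0.
Proof.
move=> Xf; have /finite_seqP[s es] : finite_set
    (\bigcup_(x in X) [set j : {classic J} | coef j x <> 0]).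
  by apply: bigcup_finite => // x _; exact: finite_coef.
exists (undup s); split=> [|x Xx j]; first exact: undup_uniq.
rewrite mem_undup; apply: contraNP => nz.
by have : [set` s] j by rewrite -es; exists x.
Qed.

Lemma ex_support1 x : exists s : seq {classic J},
  uniq s /\ forall j : {classic J}, j \notin s -> coef j x = 0.
Proof.
have [s [us es]] := ex_support (finite_set1 x).
by exists s; split=> //; exact: es.
Qed.

Section Extend.
Variables (M : lmodType R) (m : J -> M).

Definition extend x : M := \sum_(j \in [set: {classic J}]) coef j x *: m j.

Lemma extendE x (s : seq {classic J}) : uniq s ->
  (forall j : {classic J}, j \notin s -> coef j x = 0) ->
  extend x = \sum_(j <- s) coef j x *: m j.
Proof.
move=> us xs; rewrite /extend (fsbigE s) // => [|i _ /xs ->].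
  by apply: eq_bigl => i; exact: mem_set.
exact: scale0r.
Qed.

Fact extend_linear : linear extend.
Proof.
move=> a x y; have [s [us es]] := ex_support (finite_set2 x y).
have ex (j : {classic J}) : j \notin s -> coef j x = 0 by apply: es; left.
have ey (j : {classic J}) : j \notin s -> coef j y = 0 by apply: es; right.
rewrite (extendE us ex) (extendE us ey) (extendE us) => [|j js]; last first.
  by rewrite linearP /= ex // ey // scaler0 addr0.
rewrite scaler_sumr -big_split /=; apply: eq_bigr => j _.
by rewrite linearP /= scalerDl scalerA.
Qed.

HB.instance Definition _ := GRing.isLinear.Build R V M *:%R extend extend_linear.

Lemma extend_basis j : extend (basis j) = m j.
Proof.
rewrite (@extendE _ [:: j : {classic J}]) // => [|i].
  by rewrite big_seq1 coef_basis_eq scale1r.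
by rewrite inE => /eqP; exact: coef_basis_neq.
Qed.

End Extend.

Lemma free_sum x : x = extend basis x.
Proof.
have [s [us ex]] := ex_support1 x; apply: (coef_inj (c := B)) => i.
rewrite (extendE _ us ex) linear_sum.
have [si|/[dup] /ex -> si] := boolP ((i : {classic J}) \in s).
  rewrite (big_rem _ si) /= linearZ /= coef_basis_eq regular_scale mulr1.
  rewrite big_seq big1 ?addr0 // => j; rewrite mem_rem_uniq // inE => /andP[/eqP ji _].
  by rewrite linearZ /= coef_basis_neq ?scaler0 // => e; apply: ji.
rewrite big_seq big1 // => j sj; rewrite linearZ /= coef_basis_neq ?scaler0 // => e.
by rewrite e sj in si.
Qed.

Lemma free_linear_eq (M : lmodType R) (f g : {linear V -> M}) :
  (forall j, f (basis j) = g (basis j)) -> forall x, f x = g x.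
Proof.
move=> fg x; have [s [us ex]] := ex_support1 x.
rewrite (free_sum x) (extendE _ us ex) !linear_sum.
by apply: eq_bigr => j _; rewrite !linearZ fg.
Qed.

Lemma linear_extend (M N : lmodType R) (m : J -> M) (f : {linear M -> N}) x :
  f (extend m x) = extend (f \o m) x.
Proof.
have [s [us ex]] := ex_support1 x.
by rewrite !(extendE _ us ex) linear_sum; apply: eq_bigr => j _; rewrite linearZ.
Qed.

(** The endomorphism that multiplies each coordinate on the right. *)
Lemma coef_diagonal (c : J -> R) x k :
  coef k (extend (fun j => c j *: basis j) x) = coef k x * c k.
Proof.
have [|y yE] := ex_coef B (f := fun j => coef j x * c j).
  apply: sub_finite_set (finite_coef B x) => j /= nz e; apply: nz.
  by rewrite e mul0r.
suff -> : extend (fun j => c j *: basis j) x = y by [].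
have [s [us ex]] := ex_support1 x.
rewrite [RHS]free_sum (extendE _ us ex) (extendE _ us) => [|j /ex ej].
  by apply: eq_bigr => j _; rewrite yE scalerA.
by rewrite yE ej mul0r.
Qed.

Lemma free_projective : projective V.
Proof.
move=> M N g f gs.
have h j : {m | g m = f (basis j)}.
  by apply: cid; have [m _ e] := gs (f (basis j)) I; exists m.
exists (extend (fun j => sval (h j))).
apply: (@free_linear_eq _ (g \o extend _)%FUN) => j /=.
by rewrite extend_basis; case: (h j).
Qed.

End Basis.

Section Retract.
Variable R : nzRingType.

Definition retract (P F : lmodType R) :=
  exists (i : {linear P -> F}) (r : {linear F -> P}), forall x, r (i x) = x.

Lemma projective_retract (P F : lmodType R) :
  projective F -> retract P F -> projective P.
Proof.
move=> pF [i [r ri]] M N g f gs.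
have [h gh] := pF M N g (f \o r)%FUN gs.
by exists (h \o i)%FUN => x /=; rewrite gh /= ri.
Qed.

Lemma projective_section (P M : lmodType R) (p : {linear M -> P}) :
  projective P -> (forall x, exists y, p y = x) ->
  exists s : {linear P -> M}, forall x, p (s x) = x.
Proof.
move=> pP ps; apply: (pP _ _ p (idfun : {linear P -> P})) => x _.
by have [y] := ps x; exists y.
Qed.

Lemma ex_free_retract (P : lmodType R) : projective P ->
  exists (J : Type) (F : lmodType R) (B : coordinates J F), retract P F.
Proof.
move=> pP; exists P, (direct_copower P R^o), (copower_coordinates R P).
have [x|s es] := projective_section (p := extend (copower_coordinates R P) id) pP.
  by exists (basis (copower_coordinates R P) x); rewrite /= extend_basis.
by exists s, (extend (copower_coordinates R P) id).
Qed.

Lemma iso_coordinates (A F : lmodType R) (J : Type) (B : coordinates J F)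
    (f : {linear A -> F}) : bijective f -> inhabited (coordinates J A).
Proof.
move=> [g fK gK]; split; exists (fun j => coef B j \o f)%FUN => [x y e|x|h hf].
- by apply: (can_inj fK); apply: (coef_inj (c := B)).
- exact: finite_coef.
- by have [x ex] := ex_coef B hf; exists (g x) => j /=; rewrite gK.
Qed.

End Retract.

Section Submodules.
Variable R : nzRingType.

Definition submodule (V : lmodType R) (N : set V) :=
  N 0 /\ forall a x y, N x -> N y -> N (a *: x + y).

Lemma ex_linear (U V : lmodType R) (h : U -> V) :
  (forall a x y, h (a *: x + y) = a *: h x + h y) ->
  exists f : {linear U -> V}, forall x, f x = h x.
Proof.
move=> lh.
pose f : {linear U -> V} := HB.pack h (GRing.isLinear.Build R U V *:%R h lh).
by exists f.
Qed.

(** Membership in a submodule is turned into a boolean predicate, which is the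
    form required by the algebraic hierarchy. *)
Lemma ex_submodClosed (V : lmodType R) (N : set V) : submodule N ->
  exists S : submodClosed V, forall x, x \in S <-> N x.
Proof.
move=> [N0 NP]; pose S : {pred V} := fun x => `[< N x >].
have Sc : submod_closed S.
  by split=> [|a x y /asboolP Nx /asboolP Ny]; apply/asboolP; [|exact: NP].
pose S' : submodClosed V := HB.pack S (GRing.isSubmodClosed.Build R V S Sc).
by exists S' => x; split=> /asboolP.
Qed.

(** A submodule as a module with an injection, so that its construction as a
    subtype never has to be unfolded. *)
Lemma ex_submodule (V : lmodType R) (N : set V) : submodule N ->
  exists (P : lmodType R) (i : {linear P -> V}),
    injective i /\ forall v, N v <-> exists p, i p = v.
Proof.
move=> /ex_submodClosed[S SN].
exists (submod S), (\val : {linear submod S -> V}); split; first exact: val_inj.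
move=> v; split=> [/SN Sv|[p <-]]; last exact/SN/(valP p).
by exists (exist _ v Sv).
Qed.

Lemma linear_factor (U V W : lmodType R) (i : {linear V -> W}) (f : {linear U -> W}) :
  injective i -> (forall x, exists p, i p = f x) ->
  exists r : {linear U -> V}, forall x, i (r x) = f x.
Proof.
move=> ii /choice[h hE]; have [|r rE] := @ex_linear _ _ h.
  by move=> a x y; apply: ii; rewrite linearP !hE linearP.
by exists r => x; rewrite rE hE.
Qed.

End Submodules.

(** * Projective covers *)

Section Nakayama.
Variable R : nzRingType.

(** The submodule J M, presented by the construction of its elements. *)
Inductive jacobson_mul (M : lmodType R) : M -> Prop :=
| JacobsonMul0 : jacobson_mul 0
| JacobsonMulD a x y : jacobson a -> jacobson_mul y -> jacobson_mul (a *: x + y).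

Lemma jacobson_mulZ (M : lmodType R) a (x : M) : jacobson a -> jacobson_mul (a *: x).
Proof. by move=> Ja; rewrite -[_ *: _]addr0; apply: JacobsonMulD => //; left. Qed.

Lemma jacobson_mul_submodule (M : lmodType R) : submodule (@jacobson_mul M).
Proof.
split=> [|a x y + Jy]; first by left.
elim=> [|b z w Jb _ IH]; first by rewrite scaler0 add0r.
by rewrite scalerDr scalerA -addrA; apply: JacobsonMulD; [exact: jacobsonMl|].
Qed.

(** If p x is outside N then, writing x = n + sum a_i y_i with a_i in the
    radical, some p a_i y_i is outside N.  Iterating gives an infinite product
    of radical elements without a vanishing initial segment, against
    T-nilpotence. *)
Lemma nakayama (M : lmodType R) (N : set M) : right_dcc R -> submodule N ->
  (forall x, exists n k, [/\ N n, jacobson_mul k & x = n + k]) -> forall x, N x.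
Proof.
move=> dccR [N0 NP] NJ x0; apply: contrapT => Nx0.
have NZ a x : N x -> N (a *: x) by move=> Nx; rewrite -[_ *: _]addr0; exact: NP.
have next (s : R * M) : {t : R * M | jacobson t.1 /\
    (~ N (s.1 *: s.2) -> ~ N ((s.1 * t.1) *: t.2))}.
  case: s => p m; apply: cid => /=; have [Nm|Nm] := pselect (N (p *: m)).
    by exists (0, 0); split=> //; exact: jacobson0.
  have [n [k [Nn Jk mE]]] := NJ m.
  have : ~ N (p *: k) by move=> Nk; apply: Nm; rewrite mE scalerDr; exact: NP.
  elim: Jk {mE} => [|a x y Ja _ IH Npk]; first by rewrite scaler0.
  have [Nax|Nax] := pselect (N ((p * a) *: x)); last by exists (a, x).
  by apply: IH => Ny; apply: Npk; rewrite scalerDr scalerA -[_ *: x]scale1r; exact: NP.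
pose xs := fix xs n : R * M := if n is n'.+1
  then ((xs n').1 * (sval (next (xs n'))).1, (sval (next (xs n'))).2) else (1, x0).
have xsN n : ~ N ((xs n).1 *: (xs n).2).
  by elim: n => [|n IH] /=; [rewrite scale1r|case: (next (xs n)) => t /= [_]; exact].
have [|n e] := @jacobson_tnilp R dccR (fun n => (xs n).1) (fun n => (sval (next (xs n))).1)
   _ (fun n => erefl).
  by move=> n; case: (next (xs n)) => t [].
by apply: (xsN n); rewrite e scale0r.
Qed.

End Nakayama.

(** Finitely many elements of the union of a chain lie in one of its members;
    this is what makes independence a property of finite character. *)
Lemma seq_sub_chain (T : Type) (F : set (set T)) (X0 : set T) (s : seq {classic T}) :
  total_on F subset -> F X0 -> exists X, [/\ F X, X0 `<=` X
    & forall j, j \in s -> (\bigcup_(Y in F) Y) j -> X j].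
Proof.
move=> tF FX0; elim: s => [|i s [X [FX X0X sX]]]; first by exists X0; split.
have [[Y FY Yi]|Fi] := pselect ((\bigcup_(Y in F) Y) i); last first.
  exists X; split=> // j; rewrite inE => /predU1P[->|js] Fj //; exact: sX.
have [XY|YX] := tF X Y FX FY.
  exists Y; split=> //; first exact: subset_trans XY.
  by move=> j; rewrite inE => /predU1P[->|js] Fj //; apply: XY; exact: sX.
exists X; split=> // j; rewrite inE => /predU1P[->|js] Fj; first exact: YX.
exact: sX.
Qed.

Section ProjectiveCover.
Variables (R : nzRingType) (M V : lmodType R) (B : coordinates M V) (phi : M -> R).
Implicit Types (m : M) (x : V) (T : set M).
Hypothesis dccR : right_dcc R.

Let good m := local_idempotent (phi m) /\ phi m *: m = m.

Hypothesis phiP : forall m f, local_idempotent f -> f *: m = m -> good m.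

Let ev : {linear V -> M} := extend B id.

(** For m in T the map R phi(m) -> M sending phi(m) to m induces a map from the
    simple module R phi(m) / J phi(m) to M / J M; independence of T says that
    the induced map from the direct sum of these simple modules is
    injective. *)
Definition tops_independent T := (forall m, T m -> good m) /\
  forall x, (forall m, ~ T m -> coef B m x = 0) -> jacobson_mul (ev x) ->
    forall m, T m -> jacobson (coef B m x * phi m).

Lemma ex_maximal_independent : exists T, tops_independent T /\
  forall T', T `<` T' -> ~ tops_independent T'.
Proof.
apply: Zorn_bigcup => F FP tF; split=> [m [X FX Xm]|x xF Jx m [X0 FX0 X0m]].
  by have [gX _] := FP X FX; exact: gX.
have [s [us sx]] := ex_support1 B x.
have [X [FX X0X sX]] := seq_sub_chain s tF FX0; have [_] := FP X FX.
apply=> // [j Xj|]; last exact: X0X.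
have [js|/sx //] := boolP ((j : {classic M}) \in s).
by apply: xF => Fj; apply: Xj; exact: sX.
Qed.

(** P is the direct sum of the R phi(m) for m in a maximal independent T,
    realized inside the free module on M as the fixed points of the idempotent
    endomorphism pr.  Maximality gives M = p(P) + J M, so p is onto by
    Nakayama's lemma; independence puts its kernel inside J P, so the kernel is
    superfluous, again by Nakayama's lemma. *)
Lemma has_cover : has_projective_cover M.
Proof.
have [T [[gT iT] maxT]] := ex_maximal_independent.
pose c m : R := if `[< T m >] then phi m else 0.
have cT m : T m -> c m = phi m by rewrite /c; case: asboolP.
have cNT m : ~ T m -> c m = 0 by rewrite /c; case: asboolP.
have cc m : c m * c m = c m.
  rewrite /c; case: asboolP => [/gT[[] //]|_]; exact: mulr0.
pose pr : {linear V -> V} := extend B (fun m => c m *: basis B m).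
have prE m x : coef B m (pr x) = coef B m x * c m by exact: coef_diagonal.
have [|P [i [inj_i iP]]] := @ex_submodule R V [set x | pr x = x].
  split=> [|a x y ex ey]; first exact: linear0.
  by rewrite /mkset linearP; congr (_ *: _ + _).
have [|r rE] := linear_factor (f := pr) inj_i.
  move=> x; apply/iP/(coef_inj (c := B)) => m.
  by rewrite !prE -mulrA cc.
have pri q : pr (i q) = i q by apply/iP; exists q.
have ri q : r (i q) = q by apply: inj_i; rewrite rE pri.
pose p : {linear P -> M} := (ev \o i)%FUN.
have evpr x : (forall m, ~ T m -> coef B m x = 0) -> ev (pr x) = ev x.
  move=> xT; rewrite /pr linear_extend.
  have [s [us sx]] := ex_support1 B x; rewrite /ev /= !(extendE _ us sx).
  apply: eq_bigr => m _ /=; rewrite linearZ /= extend_basis.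
  have [Tm|/xT ->] := pselect (T m); last by rewrite !scale0r.
  by rewrite cT // (gT m Tm).2.
have pb m : T m -> p (r (basis B m)) = m.
  move=> Tm; rewrite /p /= rE evpr ?/ev /= ?extend_basis // => k Tk.
  by rewrite coef_basis_neq // => e; apply: Tk; rewrite e.
pose NJ m := exists n k, [/\ exists q, p q = n, jacobson_mul k & m = n + k].
have [J0 JP] := jacobson_mul_submodule M.
have NJP a m n : NJ m -> NJ n -> NJ (a *: m + n).
  move=> [_ [k [[q <-] Jk ->]]] [_ [k' [[q' <-] Jk' ->]]].
  exists (p (a *: q + q')), (a *: k + k'); split; [by exists (a *: q + q')|exact: JP|].
  by rewrite linearP scalerDr addrACA.
have NJp q : NJ (p q) by exists (p q), 0; rewrite addr0; split=> //; exists q.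
have NJJ k : jacobson_mul k -> NJ k.
  by move=> Jk; exists 0, k; rewrite add0r; split=> //; exists 0; rewrite linear0.
have NJZ a m : NJ m -> NJ (a *: m).
  by move=> Nm; rewrite -[_ *: _]addr0; apply: NJP => //; exact: NJJ.
have NJN m n : NJ m -> NJ n -> NJ (m - n).
  by move=> Nm Nn; rewrite addrC -scaleN1r; exact: NJP.
(* Otherwise m could be added to T.  Given a relation x on the larger set, x'
   is its part supported on T; if the coefficient of m were outside the
   radical, phi m would be a left multiple of it and m would lie in
   p(P) + J M. *)
have NJf f m : local_idempotent f -> f *: m = m -> NJ m.
  move=> lf fm; have gm := phiP lf fm; apply: contrapT => NJm.
  have nTm : ~ T m by move=> Tm; apply: NJm; rewrite -(pb m Tm).
  apply: (maxT (T `|` [set m])).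
    by split=> [k|TU]; [left|apply/nTm/TU; right].
  split=> [k [/gT|->] //|x xT Jx].
  pose x' := x - coef B m x *: basis B m.
  have x'm : coef B m x' = 0.
    by rewrite linearB linearZ /= coef_basis_eq regular_scale mulr1 subrr.
  have x'k k : k <> m -> coef B k x' = coef B k x.
    by move=> km; rewrite linearB linearZ /= coef_basis_neq // scaler0 subr0.
  have x'T k : ~ T k -> coef B k x' = 0.
    move=> Tk; have [->//|km] := pselect (k = m).
    by rewrite x'k // xT // => -[].
  have evx' : ev x' = ev x - coef B m x *: m.
    by rewrite linearB linearZ /= extend_basis.
  have Jc : jacobson (coef B m x * phi m).
    apply: contrapT => /(local_idempotent_left gm.1)[s es]; apply: NJm.
    rewrite -gm.2 es -mulrA -scalerA -scalerA gm.2; apply: NJZ.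
    have -> : coef B m x *: m = ev x - ev x' by rewrite evx' opprB addrC subrK.
    by apply: NJN; [exact: NJJ|rewrite -evpr // -rE; exact: NJp].
  move=> k [Tk|-> //]; rewrite -x'k; last by move=> e; apply: nTm; rewrite -e.
  apply: iT => //; rewrite evx' -[X in _ *: X]gm.2 scalerA addrC -scaleNr.
  exact/JacobsonMulD/Jx/jacobsonN.
have NJS y : local_sum y -> forall m, NJ (y *: m).
  elim=> [j Jj m|f a z lf _ IH m]; first exact/NJJ/jacobson_mulZ.
  rewrite scalerDl -scalerA -[f *: _]scale1r; apply: NJP => //.
  by apply: (NJf f) => //; rewrite scalerA; case: lf => ->.
have ps m : exists q, p q = m.
  apply: (nakayama dccR (N := fun m => exists q, p q = m)).
    split; first by exists 0; rewrite linear0.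
    by move=> a _ _ [q <-] [q' <-]; exists (a *: q + q'); rewrite linearP.
  by move=> {}m; have := NJS 1 (local_sum1 dccR) m; rewrite scale1r.
exists P, p; split.
- by apply: (projective_retract (free_projective B)); exists i, r.
- by move=> m _; have [q] := ps m; exists q.
move=> N NK; apply: (@nakayama R P [set x | x \in N] dccR).
  by split=> [|a x y Nx Ny]; rewrite /mkset ?rpred0 // rpredD ?rpredZ.
move=> q; have [n Nn [k /= pk0 ->]] := NK q; exists n, k; split=> //.
(* An element k of the kernel is the image under r of its expansion in the
   free module; there its coefficients lie in the radical by independence. *)
rewrite -(ri k) [X in r X](free_sum B) linear_extend.
have [s [us sx]] := ex_support1 B (i k); rewrite (extendE _ us sx) /=.
have Jk m : jacobson (coef B m (i k) : R).
  rewrite -pri prE; have [Tm|/cNT ->] := pselect (T m); last first.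
    by rewrite mulr0; exact: jacobson0.
  rewrite cT //; apply: iT => // [j Tj|]; last by have -> : ev (i k) = 0 := pk0; left.
  by rewrite -pri prE cNT // mulr0.
elim: s {us sx} => [|m s IH]; first by rewrite big_nil; left.
by rewrite big_cons; apply: JacobsonMulD => //; exact: Jk.
Qed.

End ProjectiveCover.

Lemma right_dcc_left_perfect (R : nzRingType) : right_dcc R -> left_perfect R.
Proof.
move=> dccR M.
have /choice[phi phiP] (m : M) : exists f : R,
    (exists g, local_idempotent g /\ g *: m = m) -> local_idempotent f /\ f *: m = m.
  have [[f fP]|no] := pselect (exists g, local_idempotent g /\ g *: m = m).
    by exists f.
  by exists 0.
apply: (@has_cover R M _ (copower_coordinates R M) phi dccR).
by move=> m f lf fm; apply: phiP; exists f.
Qed.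

(** * Flat modules over a left perfect ring *)

Section Flat.
Variable R : nzRingType.

(** The equational criterion: every linear relation in F comes from relations
    between scalars. *)
Definition flat (F : lmodType R) :=
  forall n (b : 'I_n -> R) (y : 'I_n -> F), \sum_(i < n) b i *: y i = 0 ->
  exists m (c : 'I_n -> 'I_m -> R) (z : 'I_m -> F),
    (forall i, y i = \sum_(j < m) c i j *: z j) /\
    forall j, \sum_(i < n) b i * c i j = 0.

Lemma superfluous_submodule (P : lmodType R) (K N : set P) :
  superfluous K -> submodule N ->
  (forall x, exists n k, [/\ N n, K k & x = n + k]) -> forall x, N x.
Proof.
move=> supK /ex_submodClosed[S SN] NK x; apply/SN; apply: supK => {}x.
have [n [k [Nn Kk xE]]] := NK x.
by exists n; [exact/SN|exists k].
Qed.

Lemma range_submodule (U V : lmodType R) (f : {linear U -> V}) :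
  submodule [set v | exists u, f u = v].
Proof.
split; first by exists 0; rewrite linear0.
by move=> a _ _ [u <-] [v <-]; exists (a *: u + v); rewrite linearP.
Qed.

(** For such an f the map 1 - f is onto because ker p is superfluous, so it has
    a section h.  The image of h is everything too, since q - h (q - f q) lies
    in ker p; hence 1 - f is injective, and it kills x. *)
Lemma pure_superfluous_eq0 (P F : lmodType R) (p : {linear P -> F}) x :
  projective P -> superfluous [set x | p x = 0] ->
  (exists f : {linear P -> P}, (forall q, p (f q) = 0) /\ f x = x) -> x = 0.
Proof.
move=> pP supK [f [pf fx]].
have [g gE] : exists g : {linear P -> P}, forall q, g q = q - f q.
  by exists (idfun \- f)%FUN.
have pg q : p (g q) = p q by rewrite gE linearB pf subr0.
have gs q : exists t, g t = q.
  apply: (superfluous_submodule supK (range_submodule g)) => {}q.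
  by exists (g q), (f q); split; [exists q|exact: pf|rewrite gE subrK].
have [h gh] := projective_section pP gs.
have [t xE] : exists t, h t = x.
  apply: (superfluous_submodule supK (range_submodule h)) => q.
  exists (h (g q)), (q - h (g q)); split; first by exists (g q).
    by rewrite /mkset -pg linearB gh subrr linear0.
  by rewrite addrC subrK.
by rewrite -xE -[t]gh xE gE fx subrr linear0.
Qed.

(** For x in the kernel of a projective cover p, the expansion of x in a free
    module containing P as a summand is mapped by p to a linear relation in F.
    Writing that relation as in the equational criterion and lifting the
    witnesses z to P corrects the basis vectors into ker p without changing
    the combination x, which gives an endomorphism of P into ker p that fixes
    x. *)
Lemma flat_projective (F : lmodType R) : left_perfect R -> flat F -> projective F.
Proof.
move=> perfR flF; have [P [p [pP ps supK]]] := perfR F.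
have [J [V [B [i [r ri]]]]] := ex_free_retract pP.
have {}ps (y : F) : exists q, p q = y by have [q _ e] := ps y I; exists q.
have p_inj : injective p.
  suff p0 x : p x = 0 -> x = 0.
    by move=> x y e; apply/eqP; rewrite -subr_eq0; apply/eqP/p0; rewrite linearB e subrr.
  move=> px0; apply: (pure_superfluous_eq0 pP supK).
  have [s [us sx]] := ex_support1 B (i x).
  pose jj (k : 'I_(size s)) := tnth (in_tuple s) k.
  pose b k : R := coef B (jj k) (i x); pose u k := r (basis B (jj k)).
  have xE : x = \sum_k b k *: u k.
    rewrite -[LHS]ri [X in r X](free_sum B) linear_extend (extendE _ us sx).
    exact: big_tnth.
  have [|m [c [z [yz bc]]]] := flF _ b (p \o u).
    by rewrite -[RHS]px0 [in RHS]xE linear_sum; apply: eq_bigr => k _; rewrite linearZ.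
  have w k : {t | p t = z k} by exact: cid.
  pose v k := u k - \sum_j c k j *: sval (w j).
  have pv k : p (v k) = 0.
    rewrite linearB [p (u k)]yz linear_sum -sumrB big1 // => j _.
    by rewrite linearZ /= (svalP (w j)) subrr.
  have [f fE] : exists f : {linear P -> P},
      forall q, f q = \sum_k coef B (jj k) (i q) *: v k.
    apply: ex_linear => a q t.
    under eq_bigr => k _ do rewrite !linearP /= scalerDl regular_scale -scalerA.
    by rewrite big_split scaler_sumr.
  exists f; split=> [q|].
    by rewrite fE linear_sum big1 // => k _; rewrite linearZ /= pv scaler0.
  rewrite fE [RHS]xE; under eq_bigr => k _ do rewrite scalerBr scaler_sumr.
  rewrite sumrB exchange_big [X in _ - X]big1 ?subr0 // => j _.
  under eq_bigr => k _ do rewrite scalerA.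
  by rewrite -scaler_suml bc scale0r.
have [|s sE] := linear_factor (f := (idfun : {linear F -> F})) p_inj; first exact: ps.
by apply: (projective_retract pP); exists s, p.
Qed.

Lemma projective_flat (P : lmodType R) : projective P -> flat P.
Proof.
move=> pP n b y by0; have [J [V [B [i [r ri]]]]] := ex_free_retract pP.
have [|s [us sy]] := @ex_support _ _ _ B [set i (y k) | k in [set: 'I_n]].
  exact/finite_image/finite_finset.
have {}sy k (j : {classic J}) : j \notin s -> coef B j (i (y k)) = 0.
  by apply: sy; exists k.
exists (size s), (fun k l => coef B (tnth (in_tuple s) l) (i (y k))).
exists (fun l => r (basis B (tnth (in_tuple s) l))); split=> [k|l].
  rewrite -[LHS]ri [X in r X](free_sum B) linear_extend (extendE _ us (sy k)).
  exact: big_tnth.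
set j := tnth _ _; rewrite -[RHS](linear0 (coef B j)) -(linear0 i) -by0 !linear_sum.
by apply: eq_bigr => k _; rewrite !linearZ.
Qed.

End Flat.

(** * Syzygies and products of projective modules *)

Lemma val_submodZ (R : nzRingType) (V : lmodType R) (S : submodClosed V) a
    (y : submod S) : val (a *: y) = a *: val y.
Proof. by []. Qed.

(** A linear system whose right-hand side is solvable in each coordinate is
    solvable; only the finitely many coordinates in the support matter, which
    keeps the solution finitely supported. *)
Lemma free_solve (R : nzRingType) (J : Type) (A : lmodType R) (B : coordinates J A) n m
    (C : 'M[R]_(n, m)) (y : 'I_n -> A) :
  (forall j, exists a, \col_k (coef B j (y k) : R) = C *m a) ->
  exists z, forall i, y i = \sum_j C i j *: z j.
Proof.
move=> /choice[a aE]; have [|s [us sy]] := @ex_support _ _ _ B [set y k | k in [set: 'I_n]].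
  exact/finite_image/finite_finset.
have {}sy k (j : {classic J}) : j \notin s -> coef B j (y k) = 0.
  by apply: sy; exists k.
exists (fun k => \sum_(j <- s) (a j) k 0 *: basis B j) => k.
rewrite [LHS](free_sum B) (extendE _ us (sy k)).
under [RHS]eq_bigr => l _ do rewrite scaler_sumr.
rewrite exchange_big; apply: eq_bigr => j _ /=.
under eq_bigr => l _ do rewrite scalerA.
rewrite -scaler_suml; congr (_ *: _).
have := congr1 (fun w : 'cV[R]_n => w k 0) (aE j).
by rewrite /= !mxE.
Qed.

Section Syzygies.
Variable R : nzRingType.

(** The right module of relations of any finite family of scalars is finitely
    generated, by the columns of C. *)
Definition finite_syzygies := forall n (b : 'rV[R]_n),
  exists m (C : 'M[R]_(n, m)), b *m C = 0 /\
    forall v : 'cV_n, b *m v = 0 -> exists a, v = C *m a.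

Lemma converse_scale (a b : R) : (a : R^c) *: (b : (R^c)^o) = b * a.
Proof. by []. Qed.

(** Schanuel's argument: coherence provides one finite family F that generates
    the right ideal of the entries of b and whose relations are generated by
    the columns of a matrix G.  With matrices such that b beta = F and
    F alpha = b, the relations of b are generated by the columns of beta G and
    of 1 - beta alpha. *)
Lemma coherent_syzygies : right_coherent R -> finite_syzygies.
Proof.
move=> cohR n b.
pose S : {pred (R^c)^o} := fun x => `[< exists a : 'cV[R]_n, x = (b *m a) 0 0 >].
have Sc : submod_closed S.
  split=> [|r _ _ /asboolP[a ->] /asboolP[a' ->]]; apply/asboolP.
    by exists 0; rewrite mulmx0 mxE.
  exists (\matrix_(i, j) (a i j * (r : R)) + a').
  rewrite mulmxDr [RHS]mxE; suff <- : (b *m a) 0 0 * (r : R) =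
    (b *m \matrix_(i, j) (a i j * (r : R))) 0 0 by [].
  by rewrite !mxE big_distrl; apply: eq_bigr => i _; rewrite mxE mulrA.
pose S' : submodClosed (R^c)^o := HB.pack S (GRing.isSubmodClosed.Build R^c _ S Sc).
have [|N [f [fs [M [g kf]]]]] := cohR S'.
  exists n, (fun i => b 0 i); apply/seteqP; split=> [x /asboolP[a ->]|x [a ->]].
    by exists (fun i => a i 0); rewrite mxE.
  by apply/asboolP; exists (\col_i a i); rewrite mxE; apply: eq_bigr => i _; rewrite mxE.
pose vf v : R := val (f v).
have vf0 : vf 0 = 0 by rewrite /vf linear0.
have vfD v w : vf (v + w) = vf v + vf w by rewrite /vf linearD.
have vfZ a v : vf (a *: v) = vf v * (a : R).
  by rewrite /vf linearZ; apply: etrans (val_submodZ a (f v)) (converse_scale _ _).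
pose F : 'rV[R]_N := \row_k (val (f (delta_mx 0 k)) : R).
have fE (u : 'cV[R]_N) : (F *m u) 0 0 = val (f (\row_k (u k 0 : R^c))) :> R.
  rewrite -[RHS]/(vf _) [X in vf X]row_sum_delta (big_morph vf vfD vf0) mxE.
  by apply: eq_bigr => k _; rewrite !mxE vfZ.
have [beta bF] : exists beta : 'M[R]_(n, N), b *m beta = F.
  have h k : {a : 'cV[R]_n | val (f (delta_mx 0 k)) = (b *m a) 0 0 :> R}.
    by apply/cid/asboolP/(valP (f _)).
  exists (\matrix_(i, k) (sval (h k)) i 0); apply/rowP => k.
  rewrite [RHS]mxE; apply: etrans (esym (svalP (h k))).
  by rewrite !mxE; apply: eq_bigr => i _; rewrite !mxE.
have [alpha Fa] : exists alpha : 'M[R]_(N, n), F *m alpha = b.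
  have h i : {u : 'cV[R]_N | (F *m u) 0 0 = b 0 i}.
    apply: cid; have Si : (b 0 i : (R^c)^o) \in S'.
      apply/asboolP; exists (delta_mx i 0); rewrite mxE (bigD1 i) //= big1 ?addr0.
        by rewrite mxE !eqxx mulr1.
      by move=> j ji; rewrite mxE (negbTE ji) mulr0.
    have [u _ fu] := fs (exist (fun x => x \in S') _ Si : submod S') I; exists (\col_k (u 0 k : R)).
    rewrite fE (_ : \row_k _ = u) ?fu //.
    by apply/rowP => k; rewrite !mxE.
  exists (\matrix_(k, i) (sval (h i)) k 0); apply/rowP => i.
  rewrite [LHS]mxE -[RHS](svalP (h i)) mxE; apply: eq_bigr => k _.
  by congr (_ * _); rewrite mxE.
pose G : 'M[R]_(N, M) := \matrix_(k, j) (g j 0 k : R).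
have FG0 : F *m G = 0.
  apply/rowP => j; rewrite [RHS]mxE.
  have : [set v | f v = 0] (g j).
    rewrite kf; exists (fun k => (k == j)%:R); rewrite (bigD1 j) //= eqxx scale1r.
    by rewrite big1 ?addr0 // => k /negbTE ->; rewrite scale0r.
  move=> /= gj0; have := fE (col j G); rewrite (_ : \row_k _ = g j).
    by rewrite gj0 => /= <-; rewrite !mxE; apply: eq_bigr => k _; rewrite !mxE.
  by apply/rowP => k; rewrite !mxE.
have FGa (u : 'cV[R]_N) : F *m u = 0 -> exists a, u = G *m a.
  move=> Fu0; have : [set v | f v = 0] (\row_k (u k 0 : R^c)).
    by apply: val_inj; rewrite /= -fE Fu0 mxE.
  rewrite kf => -[a ua]; exists (\col_j (a j : R)).
  apply/colP => k; have := congr1 (fun v : 'rV[R^c]_N => v 0 k) ua.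
  rewrite /= mxE => ->; rewrite summxE mxE; apply: eq_bigr => j _.
  by rewrite !mxE.
exists (M + n)%N, (row_mx (beta *m G) (1%:M - beta *m alpha)); split.
  by rewrite mul_mx_row mulmxBr !mulmxA bF FG0 Fa mulmx1 subrr row_mx0.
move=> v bv0; have [|a va] := FGa (alpha *m v); first by rewrite mulmxA Fa.
exists (col_mx a v); rewrite mul_row_col mulmxBl mul1mx -!mulmxA -va.
by rewrite addrCA subrr addr0.
Qed.

Lemma syzygies_coherent : finite_syzygies -> right_coherent R.
Proof.
move=> syz I [n [x Ix]].
have [m [C [bC0 bC]]] := syz n (\row_i (x i : R)).
have xI i : x i \in I.
  have : [set` I] (x i).
    rewrite Ix; exists (fun k => (k == i)%:R); rewrite (bigD1 i) //= eqxx scale1r.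
    by rewrite big1 ?addr0 // => k /negbTE ->; rewrite scale0r.
  by [].
have [f fE] : exists f : {linear 'rV[R^c]_n -> submod I},
    forall v, f v = \sum_i v 0 i *: (exist _ (x i) (xI i) : submod I).
  apply: ex_linear => a v w; under eq_bigr => i _ do rewrite !mxE scalerDl -scalerA.
  by rewrite big_split scaler_sumr.
have vfE v : val (f v) =  ((\row_i (x i : R)) *m (\col_i (v 0 i : R))) 0 0.
  rewrite fE (big_morph (fun v : submod I => val v : R) (id1 := 0) (op1 := +%R)) // mxE.
  by apply: eq_bigr => i _; rewrite !mxE.
exists n, f; split=> [y _|].
  have : [set` I] (val y) by exact: valP.
  rewrite Ix => -[a ya]; exists (\row_i a i) => //; apply: val_inj.
  rewrite vfE [RHS]ya mxE; apply: eq_bigr => i _; rewrite !mxE.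
  by [].
exists m, (fun j => \row_i (C i j : R^c)); apply/seteqP; split=> v /=.
  move=> fv0; have [|a va] := bC (\col_i (v 0 i : R)).
    by apply/rowP => k; rewrite ord1 -vfE fv0 mxE.
  exists (fun j => a j 0 : R); apply/rowP => i.
  have := congr1 (fun w : 'cV[R]_n => w i 0) va; rewrite /= mxE => ->.
  by rewrite mxE summxE; apply: eq_bigr => j _; rewrite !mxE.
move=> [a ->]; rewrite linear_sum big1 // => j _; rewrite linearZ.
rewrite (_ : f _ = 0); [exact: scaler0|apply: val_inj; rewrite vfE].
transitivity ((\row_i (x i : R) *m C) 0 j); last by rewrite bC0 mxE.
by rewrite !mxE; apply: eq_bigr => i _; rewrite !mxE.
Qed.

(** Projective modules are flat over the ring: relations with coefficients b
    in P are combinations of the scalar syzygies of b, with a choice of C that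
    does not depend on P. *)
Lemma projective_syzygies (P : lmodType R) n m (b : 'rV[R]_n) (C : 'M[R]_(n, m))
    (y : 'I_n -> P) : projective P ->
  (forall v : 'cV_n, b *m v = 0 -> exists a, v = C *m a) ->
  \sum_i b 0 i *: y i = 0 -> exists z, forall i, y i = \sum_j C i j *: z j.
Proof.
move=> pP bC by0; have [J [V [B [i [r ri]]]]] := ex_free_retract pP.
have [|z zE] := free_solve (B := B) (C := C) (y := i \o y).
  move=> j; apply/bC/rowP => l; rewrite [RHS]mxE -[RHS](linear0 (coef B j)) -(linear0 i).
  rewrite -[X in i X]by0 !linear_sum mxE; apply: eq_bigr => k _.
  by rewrite !mxE !linearZ.
exists (r \o z) => k; rewrite -[LHS]ri [X in r X]zE linear_sum.
by apply: eq_bigr => j _; rewrite linearZ.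
Qed.

Lemma dprod_sumE (I : Type) (M : I -> lmodType R) (T : Type) (s : seq T)
    (F : T -> dprod M) i : (\sum_(t <- s) F t) i = \sum_(t <- s) F t i.
Proof. by elim: s => [|t s IH]; rewrite ?big_nil // !big_cons -IH. Qed.

(** Since one matrix C of syzygies works in every factor, the solutions found
    factor by factor assemble into a solution in the product. *)
Lemma dprod_flat (I : Type) (M : I -> lmodType R) : finite_syzygies ->
  (forall i, projective (M i)) -> flat (dprod M).
Proof.
move=> syz pM n b y by0; have [m [C [bC0 bC]]] := syz n (\row_i b i).
have h i : {z : 'I_m -> M i | forall k, y k i = \sum_j C k j *: z j}.
  apply/cid/(projective_syzygies (pM i) bC).
  transitivity ((\sum_k b k *: y k : dprod M) i); last by rewrite by0.
  by rewrite dprod_sumE; apply: eq_bigr => k _; rewrite mxE.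
exists m, (fun k j => C k j), (fun j => (fun i => sval (h i) j) : dprod M); split=> [k|j].
  apply: functional_extensionality_dep => i; rewrite dprod_sumE (svalP (h i)).
  by [].
transitivity ((\row_i b i *m C) 0 j); last by rewrite bC0 mxE.
by rewrite mxE; apply: eq_bigr => i _; rewrite mxE.
Qed.

Lemma dprod_projective (I : Type) (M : I -> lmodType R) :
  right_coherent R -> left_perfect R ->
  (forall i, projective (M i)) -> projective (dprod M).
Proof.
move=> cohR perfR pM; apply: flat_projective => //.
exact/dprod_flat/pM/coherent_syzygies.
Qed.

End Syzygies.

(** * Quotients, locally split submodules and absorption *)

Section Quotient.
Variables (R : nzRingType) (V : lmodType R) (N : set V).
Hypothesis subN : submodule N.

Let N0 : N 0. Proof. by case: subN. Qed.
Let NP a x y : N x -> N y -> N (a *: x + y). Proof. by case: subN => _; exact. Qed.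
Let NZ a x : N x -> N (a *: x).
Proof. by move=> Nx; rewrite -[_ *: _]addr0; exact: NP. Qed.
Let ND x y : N x -> N y -> N (x + y).
Proof. by move=> Nx Ny; rewrite -[x]scale1r; exact: NP. Qed.
Let NN x : N x -> N (- x). Proof. by move=> Nx; rewrite -scaleN1r; exact: NZ. Qed.

(** Equal cosets are equal as sets, so the choice operator picks the same
    representative from them; the quotient is the type of representatives. *)
Definition coset_rep x : V := xget 0 [set y | N (y - x)].

Lemma coset_repP x : N (coset_rep x - x).
Proof.
suff : [set y | N (y - x)] (coset_rep x) by [].
by apply: xgetPex; exists x; rewrite /mkset subrr.
Qed.

Lemma coset_rep_eq x y : N (x - y) -> coset_rep x = coset_rep y.
Proof.
move=> Nxy; congr (xget 0 _); apply/seteqP; split=> z /= Nz.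
  by rewrite -(subrK x z) -addrA; exact: ND.
by rewrite -(subrK y z) -addrA -(opprB x y); apply: ND => //; exact: NN.
Qed.

Definition module_quot of submodule N := {x : V | coset_rep x == x}.
Notation quot := (module_quot subN).

HB.instance Definition _ := SubChoice.on quot.

Lemma coset_repK x : coset_rep (coset_rep x) == coset_rep x.
Proof. by apply/eqP/coset_rep_eq/coset_repP. Qed.

Definition quot_pi x : quot := exist _ (coset_rep x) (coset_repK x).

Lemma quot_piE x y : quot_pi x = quot_pi y <-> N (x - y).
Proof.
split=> [/(congr1 val) /= e|/coset_rep_eq e]; last exact: val_inj.
rewrite -(subrK (coset_rep x) x) -addrA {2}e; apply: ND; last exact: coset_repP.
by rewrite -opprB; apply/NN/coset_repP.
Qed.

Lemma quot_piK (q : quot) : quot_pi (val q) = q.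
Proof. by apply: val_inj; apply/eqP/(valP q). Qed.

Lemma quot_piD x y : quot_pi (val (quot_pi x) + val (quot_pi y)) = quot_pi (x + y).
Proof. by apply/quot_piE; rewrite opprD addrACA; apply: ND; exact: coset_repP. Qed.

Lemma quot_piDr x y : quot_pi (x + val (quot_pi y)) = quot_pi (x + y).
Proof.
by apply/quot_piE; rewrite opprD addrACA subrr add0r; exact: coset_repP.
Qed.

Lemma quot_piN x : quot_pi (- val (quot_pi x)) = quot_pi (- x).
Proof. by apply/quot_piE; rewrite -opprD; apply/NN/coset_repP. Qed.

Lemma quot_piZ a x : quot_pi (a *: val (quot_pi x)) = quot_pi (a *: x).
Proof. by apply/quot_piE; rewrite -scalerBr; apply/NZ/coset_repP. Qed.

Definition quot_add (q t : quot) := quot_pi (val q + val t).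
Definition quot_opp (q : quot) := quot_pi (- val q).
Definition quot_scale a (q : quot) := quot_pi (a *: val q).

Fact quot_addA : associative quot_add.
Proof.
move=> q t u; rewrite /quot_add quot_piDr [X in _ = quot_pi X]addrC quot_piDr.
by rewrite [X in _ = quot_pi X]addrC addrA.
Qed.

Fact quot_addC : commutative quot_add.
Proof. by move=> q t; rewrite /quot_add addrC. Qed.

Fact quot_add0 : left_id (quot_pi 0) quot_add.
Proof. by move=> q; rewrite -[q in LHS]quot_piK /quot_add quot_piD add0r quot_piK. Qed.

Fact quot_addN : left_inverse (quot_pi 0) quot_opp quot_add.
Proof.
by move=> q; rewrite -[q]quot_piK /quot_add /quot_opp quot_piN quot_piD addNr.
Qed.

HB.instance Definition _ := GRing.isZmodule.Build quot
  quot_addA quot_addC quot_add0 quot_addN.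

Fact quot_scaleA (a b : R) q : quot_scale a (quot_scale b q) = quot_scale (a * b) q.
Proof. by rewrite /quot_scale quot_piZ scalerA. Qed.

Fact quot_scale1 : left_id 1 quot_scale.
Proof. by move=> q; rewrite /quot_scale scale1r quot_piK. Qed.

Fact quot_scaleDr : right_distributive quot_scale +%R.
Proof. by move=> a q t; rewrite /quot_scale [RHS]quot_piD quot_piZ scalerDr. Qed.

Fact quot_scaleDl q : {morph quot_scale^~ q : a b / a + b}.
Proof. by move=> a b; rewrite /quot_scale [RHS]quot_piD scalerDl. Qed.

HB.instance Definition _ := GRing.Zmodule_isLmodule.Build R quot
  quot_scaleA quot_scale1 quot_scaleDr quot_scaleDl.

Lemma ex_quotient : exists (Q : lmodType R) (p : {linear V -> Q}),
  (forall q, exists x, p x = q) /\ forall x, p x = 0 <-> N x.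
Proof.
have [|p pE] := @ex_linear R V quot quot_pi.
  by move=> a x y; rewrite -quot_piD -quot_piZ.
exists quot, p; split=> [q|x]; first by exists (val q); rewrite pE quot_piK.
by rewrite pE; have := quot_piE x 0; rewrite subr0.
Qed.

End Quotient.

Section LocallySplit.
Variable R : nzRingType.

(** The quotient Q of V by i(F) is flat: a relation in Q lifts to a
    combination u of elements of V lying in i(F), a map that fixes u and takes
    values in i(F) corrects the lifts into a genuine relation of V, and V is
    flat.  So Q is projective and the sequence splits. *)
Lemma locally_split_retract (F V : lmodType R) (i : {linear F -> V}) :
  left_perfect R -> projective V ->
  (forall x, exists h : {linear V -> F}, h (i x) = x) -> retract F V.
Proof.
move=> perfR pV lsi; have flV := projective_flat pV.
have i_inj : injective i.
  move=> x y e; apply/eqP; rewrite -subr_eq0; apply/eqP.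
  by have [h <-] := lsi (x - y); rewrite linearB e subrr linear0.
have [Q [p [ps p0]]] := ex_quotient (range_submodule i).
have flQ : flat Q.
  move=> n b q bq0; have h k : {x | p x = q k} by exact/cid/ps.
  pose y k := sval (h k); have yE k : p (y k) = q k := svalP (h k).
  have /p0[x xE] : p (\sum_k b k *: y k) = 0.
    by rewrite -[RHS]bq0 linear_sum; apply: eq_bigr => k _; rewrite linearZ yE.
  have [t tx] := lsi x.
  have [|m [c [z [yz bc]]]] := flV n b (fun k => y k - i (t (y k))).
    under eq_bigr => k _ do rewrite scalerBr -!linearZ.
    by rewrite sumrB -!linear_sum -xE tx subrr.
  exists m, c, (p \o z); split=> // k.
  have -> : q k = p (y k - i (t (y k))).
    rewrite linearB yE (_ : p (i _) = 0) ?subr0 //; apply/p0.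
    by exists (t (y k)).
  by rewrite yz linear_sum; apply: eq_bigr => j _; rewrite linearZ.
have [s sE] := projective_section (flat_projective perfR flQ) ps.
have [|r rE] := linear_factor (f := (idfun \- (s \o p))%FUN) i_inj.
  move=> v; have /p0[u uE] : p (v - s (p v)) = 0 by rewrite linearB sE subrr.
  by exists u.
exists i, r => x; apply: i_inj; rewrite rE /=.
have pix : p (i x) = 0 by apply/p0; exists x.
by rewrite pix linear0 subr0.
Qed.

End LocallySplit.

(** Eilenberg's swindle.  The bijection beta cuts a free module F into countably
    many blocks isomorphic to F.  If F is a summand of P, with complement Q,
    and P a summand of F, then Q is the image of an idempotent e of F, and
    Q + F is isomorphic to F by shifting the e-parts of the blocks. *)
Section Absorption.
Variables (R : nzRingType) (J : Type) (F : lmodType R) (B : coordinates J F).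
Variables (beta : nat * J -> J) (gamma : J -> nat * J).
Hypotheses (betaK : cancel beta gamma) (gammaK : cancel gamma beta).

Lemma ex_block n : exists f : {linear F -> F},
  forall x j, coef B j (f x) = coef B (beta (n, j)) x.
Proof.
have h x : {y | forall j, coef B j y = coef B (beta (n, j)) x}.
  apply/cid/ex_coef; apply: (@sub_finite_set _ _
    ((fun k : {classic J} => (gamma k).2 : {classic J}) @` [set k | coef B k x <> 0])).
    by move=> j /= nz; exists (beta (n, j)); rewrite ?betaK.
  exact/finite_image/finite_coef.
have [|f fE] := @ex_linear R F F (fun x => sval (h x)).
  move=> a x y; apply: (coef_inj (c := B)) => j.
  by rewrite linearP !(svalP (h _)) linearP.
by exists f => x j; rewrite fE (svalP (h x)).
Qed.

Definition block n : {linear F -> F} := sval (cid (ex_block n)).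

Lemma coef_block n x j : coef B j (block n x) = coef B (beta (n, j)) x.
Proof. exact: (svalP (cid (ex_block n))). Qed.

Lemma block_ext x y : (forall n, block n x = block n y) -> x = y.
Proof.
move=> e; apply: (coef_inj (c := B)) => k; rewrite -(gammaK k).
by case: (gamma k) => n j; rewrite -!coef_block e.
Qed.

Lemma block_finite x : exists N, forall n, (N <= n)%N -> block n x = 0.
Proof.
have [s [us sx]] := ex_support1 B x.
exists (\max_(k <- s) (gamma k).1.+1) => n sn.
apply: (coef_inj (c := B)) => j; rewrite coef_block linear0.
apply: sx; apply/negP => ks.
have : ((gamma (beta (n, j))).1 < n)%N.
  apply: leq_trans sn.
  exact: (@leq_bigmax_seq {classic J} s xpredT (fun k => (gamma k).1.+1)).
by rewrite betaK ltnn.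
Qed.

Lemma ex_glue (y : nat -> F) : (exists N, forall n, (N <= n)%N -> y n = 0) ->
  exists z, forall n, block n z = y n.
Proof.
move=> [N yN]; have [|z zE] := ex_coef B (f := fun k => coef B (gamma k).2 (y (gamma k).1)).
  apply: (@sub_finite_set {classic J} _ (\bigcup_(n in `I_N)
      ((fun j : {classic J} => beta (n, j) : {classic J}) @` [set j | coef B j (y n) <> 0]))).
    move=> k /= nz; exists (gamma k).1.
      rewrite /= ltnNge; apply/negP => /yN e; apply: nz.
      by rewrite e linear0.
    by exists (gamma k).2 => //=; rewrite -surjective_pairing gammaK.
  apply: bigcup_finite => [|n _]; first exact: finite_II.
  exact/finite_image/finite_coef.
by exists z => n; apply: (coef_inj (c := B)) => j; rewrite coef_block zE betaK.
Qed.

Lemma absorption (P : lmodType R) : retract F P -> retract P F -> isomorphic P F.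
Proof.
move=> [i [r ri]] [j [s sj]].
have [e eE] : exists e : {linear F -> F}, forall y, e y = j (s y - i (r (s y))).
  by exists (j \o ((idfun \- (i \o r)) \o s))%FUN.
have [f fE] : exists f : {linear F -> F}, forall y, f y = y - e y.
  by exists (idfun \- e)%FUN.
have r0 p : r (p - i (r p)) = 0 by rewrite linearB ri subrr.
have ee y : e (e y) = e y by rewrite {1}eE eE sj r0 linear0 subr0.
have ef y : e (f y) = 0 by rewrite fE linearB ee subrr.
have fe y : f (e y) = 0 by rewrite fE ee subrr.
have ff y : f (f y) = f y by rewrite {1}fE ef subr0.
have efy y : e y + f y = y by rewrite fE addrC subrK.
pose q p := j (p - i (r p)).
have eq p : e (q p) = q p by rewrite eE sj r0 linear0 subr0.
have fq p : f (q p) = 0 by rewrite fE eq subrr.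
have qP a p p' : q (a *: p + p') = a *: q p + q p'.
  by rewrite /q -linearP; congr (j _); rewrite !linearP addrACA -scalerDr.
(* Block n + 1 of the image receives the e-part of block n of r p and keeps
   its own f-part; the vacated e-part of block 0 takes the component of p in
   the complement. *)
pose y p n := if n is m.+1 then e (block m (r p)) + f (block n (r p))
  else q p + f (block 0 (r p)).
have h p : {z | forall n, block n z = y p n}.
  apply/cid/ex_glue; have [N pN] := block_finite (r p); exists N.+1 => -[//|n].
  by move=> Nn; rewrite /y !pN ?linear0 ?addr0 // ltnW.
have [|Phi PhiE] := @ex_linear R P F (fun p => sval (h p)).
  move=> a p p'; apply: block_ext => n; rewrite linearP !(svalP (h _)).
  case: n => [|n] /=; last by rewrite !linearP addrACA scalerDr.
  by rewrite qP !linearP scalerDr addrACA.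
have yE p n : block n (Phi p) = y p n by rewrite PhiE (svalP (h p)).
exists Phi; have Phi_inj : injective Phi.
  suff Phi0 p : Phi p = 0 -> p = 0.
    by move=> p p' ep; apply/eqP; rewrite -subr_eq0; apply/eqP/Phi0; rewrite linearB ep subrr.
  move=> Phip0; have y0 n : y p n = 0 by rewrite -yE Phip0 linear0.
  have q0 : q p = 0 by rewrite -eq -[LHS]addr0 -(ef (block 0 (r p))) -linearD [_ + _](y0 0) linear0.
  have fb n : f (block n (r p)) = 0.
    rewrite -ff; case: n => [|n]; first by rewrite -[RHS](linear0 f) -(y0 0) /= q0 add0r.
    by rewrite -[LHS]add0r -[X in X + _](fe (block n (r p))) -linearD [_ + _](y0 n.+1) linear0.
  have eb n : e (block n (r p)) = 0.
    by rewrite -ee -[LHS]addr0 -[X in _ + X](ef (block n.+1 (r p))) -linearD [_ + _](y0 n.+1) linear0.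
  have rp0 : r p = 0.
    by apply: block_ext => n; rewrite linear0 -[LHS]efy eb fb addr0.
  by have := congr1 s q0; rewrite sj rp0 (linear0 i) subr0 (linear0 s).
have Phi_surj z : exists p, Phi p = z.
  have [|x xE] := ex_glue (y := fun n => f (block n z) + e (block n.+1 z)).
    have [N zN] := block_finite z; exists N => n Nn.
    by rewrite !zN ?linear0 ?addr0 // ltnW.
  pose p' := s (block 0 z) - i (r (s (block 0 z))).
  exists (i x + p'); have rp : r (i x + p') = x by rewrite linearD ri r0 addr0.
  apply: block_ext => n; rewrite yE.
  case: n => [|n]; rewrite /y rp.
    rewrite /q rp addrAC subrr add0r -eE xE linearD fe ff addr0.
    exact: efy.
  by rewrite !xE !linearD !ef !ee ff fe add0r addr0 efy.
have h' z : {p | Phi p = z} by exact/cid.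
exists (fun z => sval (h' z)) => z; last exact: (svalP (h' z)).
by apply: Phi_inj; exact: (svalP (h' _)).
Qed.
End Absorption.

(** * The module of sequences of scalars *)

Section PowerIsFree.
Variable R : nzRingType.
Notation power := (direct_power nat R^o).

(** The first injection interleaves f with the characteristic function of
    n. *)
Lemma ex_bijection_blocks :
  exists beta : nat * (nat -> bool) -> (nat -> bool), bijective beta.
Proof.
have : ([set: nat * (nat -> bool)] #= [set: nat -> bool])%card.
  apply: Cantor_Bernstein; apply/pcard_injP.
    exists (fun p k => if odd k then k./2 == p.1 else p.2 k./2) => -[n f] [m g] _ _ e.
    have eh k : odd k.*2.+1 = true /\ k.*2.+1./2 = k by rewrite /= odd_double uphalf_double.
    have nm : n = m.
      have := congr1 (fun h => h n.*2.+1) e; rewrite !(eh n).1 !(eh n).2 /= eqxx.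
      by move/esym/eqP.
    congr (_, _) => //; apply: functional_extensionality_dep => k.
    by have := congr1 (fun h => h k.*2) e; rewrite odd_double doubleK.
  by exists (fun f => (0%N, f)) => f g _ _ [].
by move/card_set_bijP => [f]; rewrite setTT_bijective; exists f.
Qed.

Lemma ex_coordinate k : exists c : {linear power -> R^o}, forall v, c v = v k.
Proof. by apply: ex_linear. Qed.

(** Natural numbers code the finite binary words, that is the nodes of the
    binary tree; [branch f] is the characteristic function of the set of
    prefixes of f. *)
Definition branch (f : nat -> bool) : power := fun k =>
  if unpickle k is Some t then (t == mkseq f (size t))%:R else 0.

Lemma branchE f g n : branch f (pickle (mkseq g n)) = (mkseq g n == mkseq f n)%:R.
Proof. by rewrite /branch pickleK size_mkseq. Qed.

Lemma mkseq_separates (s : seq {classic (nat -> bool)}) : exists n,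
  forall f g, f \in s -> g \in s -> mkseq f n = mkseq g n -> f = g.
Proof.
have d (f g : nat -> bool) : {k | f k = g k -> f = g}.
  apply: cid; have [[k fgk]|fg] := pselect (exists k, f k <> g k).
    by exists k => /fgk.
  exists 0%N => _; apply: functional_extensionality_dep => k.
  by apply: contrapT => fgk; apply: fg; exists k.
exists (\max_(f <- s) \max_(g <- s) (sval (d f g)).+1) => f g fs gs e.
apply: (svalP (d f g)); set k := sval _.
have kn : (k < \max_(f <- s) \max_(g <- s) (sval (d f g)).+1)%N.
  apply: leq_trans (@leq_bigmax_seq _ s xpredT
    (fun f => \max_(g <- s) (sval (d f g)).+1) f fs isT).
  exact: (@leq_bigmax_seq _ s xpredT (fun g => (sval (d f g)).+1) g gs isT).
by have := congr1 (fun t => nth false t k) e; rewrite /= !nth_mkseq.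
Qed.

(** Finitely many distinct branches have distinct nodes at some common level n,
    and the values at these nodes recover the coefficients of a combination of
    the branches. *)
Lemma power_locally_split (F : lmodType R) (B : coordinates (nat -> bool) F) x :
  exists h : {linear power -> F}, h (extend B branch x) = x.
Proof.
have [s [us sx]] := ex_support1 B x; have [n sn] := mkseq_separates s.
have c k : {c : {linear power -> R^o} | forall v, c v = v k} by exact/cid/ex_coordinate.
have [|h hE] := @ex_linear R power F
    (fun v => \sum_(f <- s) sval (c (pickle (mkseq f n))) v *: basis B f).
  move=> a v w; under eq_bigr => f _ do rewrite linearP /= scalerDl regular_scale -scalerA.
  by rewrite big_split scaler_sumr.
exists h; rewrite hE [RHS](free_sum B) [RHS](extendE _ us sx).
rewrite big_seq [RHS]big_seq; apply: eq_bigr => f fs; congr (_ *: _).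
rewrite (extendE _ us sx) linear_sum (big_rem _ fs) /= linearZ /=.
rewrite (svalP (c _)) branchE eqxx regular_scale mulr1.
rewrite big_seq big1 ?addr0 // => g; rewrite mem_rem_uniq // inE => /andP[/eqP gf gs].
rewrite linearZ /= (svalP (c _)) branchE; case: eqP => [e|_]; last exact: scaler0.
by case: gf; apply: sn.
Qed.

Lemma ex_surjection_power : countable [set: R] ->
  exists e : (nat -> bool) -> power, forall v, exists f, e f = v.
Proof.
move=> /countable_injP[num num_inj].
pose enc (v : nat -> R) : nat -> bool := fun k =>
  if unpickle k is Some (i, j) then num (v i) == j else false.
have enc_inj v w : enc v = enc w -> v = w.
  move=> e; apply: functional_extensionality_dep => i; apply: num_inj; rewrite ?inE //.
  have := congr1 (fun f => f (pickle (i, num (v i)))) e.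
  by rewrite /enc pickleK eqxx => /esym/eqP.
have h f : {v : nat -> R | (exists w, enc w = f) -> enc v = f}.
  by apply: cid; have [[w ew]|no] := pselect (exists w, enc w = f); [exists w|exists (fun=> 0)].
exists (fun f => sval (h f)) => v; exists (enc v); apply: enc_inj.
by apply: (svalP (h _)); exists v.
Qed.

(** The branches embed the free module of rank 2^omega as a summand; the
    converse uses that R^omega has at most 2^omega elements, R being
    countable. *)
Lemma power_free : countable [set: R] -> left_perfect R -> projective power ->
  isomorphic power (direct_copower (nat -> bool) R^o).
Proof.
move=> cR perfR pP; have [beta [gamma betaK gammaK]] := ex_bijection_blocks.
pose B := copower_coordinates R (nat -> bool).
have [e es] := ex_surjection_power cR.
have [|s sE] := projective_section (p := extend B e) pP.
  by move=> v; have [f fE] := es v; exists (basis B f); rewrite /= extend_basis.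
apply: (absorption B betaK gammaK); last by exists s, (extend B e).
exact: (locally_split_retract perfR pP (power_locally_split B)).
Qed.

End PowerIsFree.

(** * Complete filtrations of abelian groups *)

(** Such sequences of sets are the bases of neighbourhoods of 0 that come from a
    complete invariant metric; completeness is stated for fast series, the only
    ones that occur. *)
Record complete_filtration (A : zmodType) (V : nat -> set A) := {
  filt0 : forall n, V n 0;
  filtN : forall n x, V n x -> V n (- x);
  filtD : forall n x y, V n.+1 x -> V n.+1 y -> V n (x + y);
  filt_sep : forall x, (forall n, V n x) -> x = 0;
  filt_complete : forall h : nat -> A, (forall n, V n (h n)) ->
    exists l, forall n, exists N, forall m, (N <= m)%N -> V n (l - \sum_(i < m) h i) }.

Definition separable_filtration (A : zmodType) (V : nat -> set A) :=
  exists D : nat -> A, forall n x, exists k, V n (x - D k).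

Section Filtration.
Variables (A : zmodType) (V : nat -> set A).
Hypothesis cV : complete_filtration V.

Lemma filtB n x y : V n.+1 x -> V n.+1 y -> V n (x - y).
Proof. by move=> Vx Vy; apply: (filtD cV) => //; exact: filtN. Qed.

Lemma filtW n m x : (n <= m)%N -> V m x -> V n x.
Proof.
move=> /subnKC <-; elim: (m - n)%N x => [|k IH] x; rewrite ?addn0 // addnS => Vx.
by apply: IH; rewrite -[x]addr0; apply: (filtD cV) => //; exact: (filt0 cV).
Qed.

Lemma filt_sum N (h : nat -> A) : (forall i, V (N + i).+1 (h i)) ->
  forall m, V N (\sum_(i < m) h i).
Proof.
move=> Vh m; elim: m N h Vh => [|m IH] N h Vh; first by rewrite big_ord0; exact: filt0.
rewrite big_ord_recl; apply: (filtD cV); first by have := Vh 0%N; rewrite addn0.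
by apply: (IH N.+1 (h \o succn)) => i; rewrite addSnnS; exact: Vh.
Qed.

(** Baire's theorem: the state of the construction is the centre and the index
    of a ball; the next ball has its centre two levels deeper, which leaves
    room for the tail of the series of increments. *)
Lemma baire (E : nat -> set A) :
  (forall j y n, exists y' m, V n (y' - y) /\ forall z, V m (z - y') -> ~ E j z) ->
  exists y, forall j, ~ E j y.
Proof.
move=> nwd.
have next j (s : A * nat) : {t : A * nat | [/\ V s.2.+2 (t.1 - s.1), (s.2 < t.2)%N
    & forall z, V t.2 (z - t.1) -> ~ E j z]}.
  apply: cid; have [y [m [Vy Em]]] := nwd j s.1 s.2.+2.
  exists (y, maxn m s.2.+1); split=> //=; first by rewrite leq_maxr.
  by move=> z /(filtW (leq_maxl _ _))/Em.
pose st := fix st j := if j is i.+1 then sval (next i (st i)) else (0, 0%N).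
pose y j := (st j).1; pose n j := (st j).2; pose h j := y j.+1 - y j.
have stP j : [/\ V (n j).+2 (h j), (n j < n j.+1)%N
    & forall z, V (n j.+1) (z - y j.+1) -> ~ E j z].
  by rewrite /h /y /n /=; case: (next j (st j)).
have nD j i : (n j + i <= n (j + i))%N.
  elim: i => [|i IH]; rewrite ?addn0 // !addnS.
  by apply: leq_ltn_trans IH _; case: (stP (j + i)%N).
have Vh j i : V (n j + i).+2 (h (j + i)%N).
  by have [+ _ _] := stP (j + i)%N; apply: filtW; rewrite !ltnS nD.
have yE j m : y (j + m)%N = y j + \sum_(i < m) h (j + i)%N.
  elim: m => [|m IH]; first by rewrite addn0 big_ord0 addr0.
  by rewrite big_ord_recr /= addrA -IH addrC addnS subrK.
have [|l lE] := filt_complete cV (h := h).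
  by move=> i; have := Vh 0%N i; rewrite add0n; apply: filtW; exact: (leq_trans (leqnSn _)).
have yl j : V (n j) (l - y j).
  have [N NE] := lE (n j).+1.
  have := NE _ (leq_addl j N); have := yE 0%N (j + N)%N.
  rewrite add0n {2}/y /= add0r => <- Vl.
  rewrite -(subrK (y (j + N)%N) l) -addrA; apply: (filtD cV) => //.
  rewrite yE addrC addKr; apply: (filt_sum (h := fun i => h (j + i)%N)) => i.
  by rewrite addSn; exact: Vh.
by exists l => j; have [_ _] := stP j; apply; exact: yl.
Qed.

End Filtration.

Section OpenMapping.
Variables (H G : zmodType) (V : nat -> set H) (W : nat -> set G) (f : {additive H -> G}).
Hypotheses (cV : complete_filtration V) (cW : complete_filtration W).
Hypothesis f_cont : forall n, exists m, forall x, V m x -> W n (f x).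

(** The closure of the image of every neighbourhood of 0 is a neighbourhood of
    0. *)
Definition almost_open := forall n, exists k, forall y, W k y ->
  forall l, exists2 x, V n x & W l (y - f x).

(** Successive approximation: the remainder z n is killed up to a smaller
    neighbourhood by the image of some h n in V n, and the series of the h n
    converges to a preimage. *)
Lemma open_mapping : almost_open ->
  exists k, forall y, W k y -> exists x, f x = y.
Proof.
move=> aof.
have kap n : {k | (n <= k)%N /\ forall y, W k y -> forall l, exists2 x, V n x & W l (y - f x)}.
  apply: cid; have [k kP] := aof n; exists (maxn n k); split; first exact: leq_maxl.
  by move=> y /(filtW cW (leq_maxr _ _))/kP.
pose k n := sval (kap n); exists (k 0%N) => y Wy.
have next n (z : G) : {x | W (k n) z -> V n x /\ W (k n.+1) (z - f x)}.
  apply: cid; have [Wz|nWz] := pselect (W (k n) z); last by exists 0.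
  have [_ kP] := svalP (kap n); have [x Vx Wx] := kP z Wz (k n.+1).
  by exists x.
pose z := fix z n := if n is m.+1 then z m - f (sval (next m (z m))) else y.
pose h n := sval (next n (z n)).
have zP n : W (k n) (z n).
  by elim: n => //= n IH; case: (next n (z n)) => x /= /(_ IH)[].
have Vh n : V n (h n) by rewrite /h; case: (next n (z n)) => x /= /(_ (zP n))[].
have zE n : z n = y - f (\sum_(i < n) h i).
  elim: n => [|n IH]; first by rewrite big_ord0 raddf0 subr0.
  by rewrite big_ord_recr raddfD opprD addrA -IH.
have [l lE] := filt_complete cV Vh; exists l.
apply/eqP; rewrite eq_sym -subr_eq0; apply/eqP; apply: (filt_sep cW) => n.
have [m mP] := f_cont n.+1; have [N NP] := lE m.
pose M := maxn N n.+1.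
have -> : y - f l = z M - f (l - \sum_(i < M) h i).
  by rewrite zE raddfB opprB addrA subrK.
apply: (filtB cW); last by apply/mP/NP; exact: leq_maxl.
apply: (filtW cW) (zP M); apply: leq_trans (svalP (kap M)).1.
exact: leq_maxr.
Qed.

(** H is covered by countably many translates of a small neighbourhood V' of 0.
    If the image of one of them were dense in some ball, then differences of
    two of its points would be dense near 0, and these are images of points of
    V' - V'. *)
Lemma not_almost_open_meager : separable_filtration V -> ~ almost_open ->
  exists E : nat -> set G, (forall x, exists j, E j (f x)) /\
    forall j y n, exists y' m, W n (y' - y) /\ forall z, W m (z - y') -> ~ E j z.
Proof.
move=> [D DP] naof.
have [n0 n0P] : exists n0, forall k, exists2 y, W k y &
    exists l, forall x, V n0 x -> ~ W l (y - f x).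
  apply: contrapT => no; apply: naof => n; apply: contrapT => nok; apply: no.
  exists n => k; apply: contrapT => noy; apply: nok; exists k => y Wy l.
  apply: contrapT => nox; apply: noy; exists y => //; exists l => x Vx Wx.
  by apply: nox; exists x.
exists (fun j => [set y | exists2 x, V n0.+1 x & y = f (D j + x)]); split=> [x|j y n].
  have [j Vj] := DP n0.+1 x; exists j, (x - D j) => //.
  by rewrite addrC subrK.
have [y0 Wy0 [l lP]] := n0P n; apply: contrapT => no.
have meet y' : W n (y' - y) -> exists x, V n0.+1 x /\ W l.+1 (f (D j + x) - y').
  move=> Wy'; apply: contrapT => nox; apply: no; exists y', l.+1; split=> // z Wz [x Vx zE].
  by apply: nox; exists x; rewrite -zE.
have [|x1 [Vx1 Wx1]] := meet y; first by rewrite subrr; exact: filt0.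
have [|x2 [Vx2 Wx2]] := meet (y + y0); first by rewrite addrC addKr.
apply: (lP (x2 - x1)); first exact: (filtB cV).
have -> : y0 - f (x2 - x1) = (f (D j + x1) - y) - (f (D j + x2) - (y + y0)).
  rewrite raddfB (raddfD f _ x1) (raddfD f _ x2).
  move: (f (D j)) (f x1) (f x2) => c a b.
  rewrite (opprB b) (opprB (c + b)) !addrA subrK opprD addrA; congr (_ - b).
  by rewrite -[c + a + y0]addrA [c + _]addrC addrK addrC.
exact: (filtB cW).
Qed.

End OpenMapping.

(** * The chain condition from a filtration *)

Lemma ex_enumeration (T : Type) (t0 : T) : countable [set: T] ->
  exists u : nat -> T, forall t, exists n, u n = t.
Proof.
move=> /countable_injP[num num_inj].
have h n : {t | (exists t', num t' = n) -> num t = n}.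
  by apply: cid; have [[t e]|no] := pselect (exists t, num t = n); [exists t|exists t0].
exists (fun n => sval (h n)) => t; exists (num t).
by apply: num_inj; rewrite ?inE //; apply: (svalP (h _)); exists t.
Qed.

Lemma not_countable_inj (T U : Type) (f : T -> U) :
  countable [set: U] -> ~ countable [set: T] -> exists x y, x <> y /\ f x = f y.
Proof.
move=> /countable_injP[num num_inj] nT; apply: contrapT => no; apply/nT/countable_injP.
exists (num \o f) => x y _ _ /(num_inj _ _ (mem_set I) (mem_set I)) e.
by apply: contrapT => xy; apply: no; exists x, y.
Qed.

Lemma countable_surj (T : Type) (g : nat -> T) :
  (forall t, exists n, g n = t) -> countable [set: T].
Proof.
move=> gs; apply/countable_injP; have /choice[h hE] := gs.
by exists h => x y _ _ e; rewrite -(hE x) -(hE y) e.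
Qed.

Section FreeUncountable.
Variables (R : nzRingType) (J : Type) (A : lmodType R) (B : coordinates J A).
Hypotheses (R_countable : countable [set: R]) (A_uncountable : ~ countable [set: A]).

Lemma uncountable_basis : ~ countable [set: J].
Proof.
move=> /countable_injP[num num_inj]; apply: A_uncountable.
have [u uP] := ex_enumeration 0 R_countable.
have /choice[dec decP] (n : nat) : exists x : A, forall j, num j = n -> x = basis B j.
  have [[j nj]|no] := pselect (exists j, num j = n); last by exists 0 => j e; case: no; exists j.
  by exists (basis B j) => k; rewrite -nj => /(num_inj _ _ (mem_set I) (mem_set I)) ->.
pose g n := if unpickle n is Some w
  then \sum_(p <- (w : seq (nat * nat))) u p.1 *: dec p.2 else 0.
apply: (@countable_surj _ g) => x; have [s [us sx]] := ex_support1 B x.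
have /choice[c cE] (j : J) : exists n, u n = coef B j x by exact: uP.
exists (pickle [seq (c j, num j) | j <- s]); rewrite /g pickleK big_map.
rewrite [RHS](free_sum B) (extendE _ us sx); apply: eq_bigr => j _ /=.
by rewrite cE (decP _ j).
Qed.

(** Some basis vector is outside all the supports of the C k, which are
    countably many finite sets. *)
Lemma free_large (p q : R) (C : nat -> A) :
  (forall r, p <> q * r) -> exists x, forall k y, p *: x - C k <> q *: y.
Proof.
move=> pq; have [[j Cj]|nj] := pselect (exists j, forall k, coef B j (C k) = 0).
  exists (basis B j) => k y /(congr1 (coef B j)); rewrite linearB !linearZ /= Cj subr0.
  by rewrite coef_basis_eq regular_scale mulr1; exact: pq.
case: uncountable_basis; apply/countable_injP.
have /choice[k kP] (j : J) : exists k, coef B j (C k) <> 0.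
  by apply: contrapT => no; apply: nj; exists j => k; apply: contrapT => nz; apply: no; exists k.
have /choice[S SP] (n : nat) : exists s : seq {classic J},
    forall j : {classic J}, j \notin s -> coef B j (C n) = 0.
  by have [s []] := ex_support1 B (C n); exists s.
have jS (j : {classic J}) : j \in S (k j) by apply/negPn/negP => /SP; exact: kP.
exists (fun j => pickle (k j, index (j : {classic J}) (S (k j)))) => j j' _ _.
move=> /(pcan_inj pickleK)[ek ei]; rewrite -[LHS](nth_index (j : {classic J}) (jS j)).
by rewrite ei ek nth_index.
Qed.

(** Uncountably many basis vectors and countably many translates of a
    neighbourhood: two basis vectors lie in the same translate, and their
    difference is small. *)
Lemma ex_small_unit (V : nat -> set A) n :
  complete_filtration V -> separable_filtration V ->
  exists j x, V n x /\ coef B j x = 1.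
Proof.
move=> cV [D DP]; have /choice[d dP] (j : J) := DP n.+1 (basis B j).
have [|j [j' [jj' e]]] := @not_countable_inj _ _ d _ uncountable_basis.
  exact: countableP.
exists j, (basis B j - basis B j'); split.
  have -> : basis B j - basis B j' = (basis B j - D (d j)) - (basis B j' - D (d j)).
    by rewrite opprB addrA subrK.
  by apply: (filtB cV); [|rewrite e]; exact: dP.
by rewrite linearB /= coef_basis_eq coef_basis_neq // subr0.
Qed.

End FreeUncountable.

Section FilteredModule.
Variables (R : nzRingType) (A : lmodType R) (V : nat -> set A).
Hypotheses (R_countable : countable [set: R]) (cV : complete_filtration V).
Hypothesis sV : separable_filtration V.
Hypothesis scal_cont : forall (r : R) n, exists m, forall x, V m x -> V n (r *: x).

Lemma scal_cont_fin (I : finType) (c : I -> R) n :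
  exists m, forall x, V m x -> forall i, V n (c i *: x).
Proof.
have h i : {m | forall x, V m x -> V n (c i *: x)} by exact/cid/scal_cont.
exists (\max_i sval (h i)) => x Vx i; apply: (svalP (h i)).
by apply: (filtW cV) Vx; exact: (@leq_bigmax I (fun i => sval (h i))).
Qed.

Lemma scal_sum_cont k (c : 'I_k -> R) n :
  exists m, forall x : 'I_k -> A, (forall i, V m (x i)) -> V n (\sum_i c i *: x i).
Proof.
elim: k c n => [|k IH] c n.
  by exists 0%N => x _; rewrite big_ord0; exact: filt0.
have [m1 m1P] := scal_cont (c ord0) n.+1.
have [m2 m2P] := IH (fun i => c (lift ord0 i)) n.+1.
exists (maxn m1 m2) => x Vx; rewrite big_ord_recl; apply: (filtD cV).
  by apply: m1P; apply: (filtW cV) (Vx _); exact: leq_maxl.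
by apply: m2P => i; apply: (filtW cV) (Vx _); exact: leq_maxr.
Qed.

(** A is a summand of the free module F, and multiplication by p is far from
    mapping A into q A when p is outside q R: even countably many translates of
    q A do not cover p A. *)
Section DescendingChain.
Variables (J : Type) (F : lmodType R) (B : coordinates J F).
Variables (i : {linear A -> F}) (r : {linear F -> A}).
Hypothesis ri : cancel i r.
Hypothesis large : forall (p q : R) (C : nat -> A), (forall s, p <> q * s) ->
  exists x, forall k y, p *: x - C k <> q *: y.

(** Let S be the set of coordinates used by hs.  The elements p D d + w, with w
    in the countable image of the combinations of basis vectors over S, are
    countably many, so some p z avoids all their translates by q A.  Replacing
    z by t = z - D d for a close D d makes it small.  If all coordinates of p t
    outside S were in q R, then p t would be such a w plus an element of
    q A. *)
Lemma ex_small_fresh (p q : R) (I : finType) (c : I -> R) n (hs : seq A) :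
  (forall s, p <> q * s) -> exists (t : A) (xi : J),
  [/\ forall k, V n (c k *: t), forall h, h \in hs -> coef B xi (i h) = 0
    & forall s, coef B xi (i (p *: t)) <> q * s].
Proof.
move=> pq; have [u uP] := ex_enumeration 0 R_countable.
have [|S [uS hS]] := @ex_support _ _ _ B [set i h | h in [set` hs]].
  exact/finite_image/finite_seq.
have [m mP] := scal_cont_fin c n; have [D DP] := sV.
pose comb (w : seq nat) := \sum_(l < size S) u (nth 0%N w l) *: r (basis B (tnth (in_tuple S) l)).
pose C k := if unpickle k is Some (d, w) then p *: D d + comb w else 0.
have [z zP] := large C pq; have [d Vd] := DP m z.
pose t := z - D d; exists t; apply: contrapT => no.
have tS (xi : {classic J}) : xi \notin S -> exists s, coef B xi (i (p *: t)) = q * s.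
  move=> xiS; apply: contrapT => nos; apply: no; exists xi; split.
  - exact: mP.
  - by move=> h hh; apply: hS => //; exists h.
  - by move=> s es; apply: nos; exists s.
have w xi : {s | (xi : {classic J}) \notin S -> coef B xi (i (p *: t)) = q * s
    /\ (coef B xi (i (p *: t)) = 0 -> s = 0)}.
  apply: cid; have [e|nz] := pselect (coef B xi (i (p *: t)) = 0).
    by exists 0; rewrite mulr0.
  have [xiS|xiS] := boolP ((xi : {classic J}) \in S); first by exists 0.
  by have [s es] := tS xi xiS; exists s.
pose g xi := if (xi : {classic J}) \in S then 0 else sval (w xi).
have gS (xi : {classic J}) : xi \in S -> g xi = 0.
  by move=> xiS; rewrite /g; case: ifPn => // /negP.
have gNS (xi : {classic J}) : xi \notin S -> coef B xi (i (p *: t)) = q * g xi.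
  move=> xiS; rewrite /g; case: ifPn => [e|_]; first by rewrite e in xiS.
  by case: (w xi) => s /= /(_ xiS)[].
have [|y yE] := ex_coef B (f := g).
  apply: sub_finite_set (finite_coef B (i (p *: t))) => xi /= nz e; apply: nz.
  rewrite /g; case: ifPn => // xiS; case: (w xi) => s /= /(_ xiS)[_]; exact.
have [ws wsE] : exists ws : seq nat, forall l : 'I_(size S),
    u (nth 0%N ws l) = coef B (tnth (in_tuple S) l) (i (p *: t)).
  have cw xi : {k | u k = coef B xi (i (p *: t))} by exact/cid/uP.
  exists [seq sval (cw xi) | xi <- S] => l.
  rewrite (nth_map (tnth (in_tuple S) l)) // (svalP (cw _)).
  by rewrite -(tnth_nth _ (in_tuple S)).
apply: (zP (pickle (d, ws)) (r y)).
rewrite /C pickleK opprD addrA -scalerBr -/t.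
have -> : comb ws = r (\sum_(j <- S) coef B j (i (p *: t)) *: basis B j).
  rewrite linear_sum big_tnth; apply: eq_bigr => l _.
  by rewrite linearZ /= wsE.
rewrite -[p *: t]ri -linearB -linearZ; congr (r _); apply: (coef_inj (c := B)) => xi.
rewrite linearB [in RHS]linearZ /= yE linear_sum.
have [xiS|xiS] := boolP ((xi : {classic J}) \in S).
  rewrite gS // (big_rem _ xiS) /= [coef B xi (_ *: basis B xi)]linearZ /= coef_basis_eq regular_scale mulr1.
  rewrite big_seq big1 ?addr0 ?ri ?subrr ?scaler0 // => j.
  rewrite mem_rem_uniq // inE => /andP[/eqP ji _].
  by rewrite [coef B xi (_ *: basis B j)]linearZ /= coef_basis_neq ?scaler0 // => e; apply: ji.
rewrite ri big_seq big1 ?subr0; first exact: gNS.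
move=> j Sj; rewrite [coef B xi (_ *: basis B j)]linearZ /= coef_basis_neq ?scaler0 // => e.
by rewrite e Sj in xiS.
Qed.

(** With q k m = a_k ... a_(m-1), the elements t n are chosen so that every tail
    sigma k = sum of q k m t_m over m >= k converges.  Then
    x_0 sigma_0 = sum of x_m t_m over m < n+1, plus x_(n+1) sigma_(n+1), and its
    coordinate at xi n is nonzero modulo x_(n+1) R.  The xi n are distinct, but
    supports are finite. *)
Lemma filtered_right_dcc : right_dcc R.
Proof.
move=> x a xS; apply: contrapT => no.
have nx n s : x n <> x n.+1 * s by move=> e; apply: no; exists n, s.
pose q k m : R := \prod_(k <= l < m) a l.
have xq n : x n = x 0%N * q 0%N n.
  elim: n => [|n IH]; first by rewrite /q big_geq // mulr1.
  by rewrite xS IH /q big_nat_recr //= mulrA.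
have /choice[next nextP] (hs : seq A) : exists ts : A * J,
  [/\ forall k : 'I_(size hs).+1, V (size hs) (q k (size hs) *: ts.1),
      forall h, h \in hs -> coef B ts.2 (i h) = 0
    & forall s, coef B ts.2 (i (x (size hs) *: ts.1)) <> x (size hs).+1 * s].
  have [t [xi [Vt ht xt]]] := @ex_small_fresh _ _ _
    (fun k : 'I_(size hs).+1 => q k (size hs)) (size hs) hs (nx (size hs)).
  by exists (t, xi).
pose hist := fix hist n := if n is m.+1
  then rcons (hist m) (next (hist m)).1 else [::].
have size_hist n : size (hist n) = n by elim: n => //= n IH; rewrite size_rcons IH.
pose t n := (next (hist n)).1; pose xi n := (next (hist n)).2.
have t_hist n m : (m < n)%N -> t m \in hist n.
  elim: n => // n IH; rewrite ltnS leq_eqVlt => /predU1P[->|/IH tm] /=.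
    by rewrite mem_rcons mem_head.
  by rewrite mem_rcons inE tm orbT.
have tV k n : (k <= n)%N -> V n (q k n *: t n).
  move=> kn; have [+ _ _] := nextP (hist n); rewrite size_hist => Vt.
  by have := Vt (Ordinal (kn : (k < n.+1)%N)).
have xi0 n m : (m < n)%N -> coef B (xi n) (i (t m)) = 0.
  by move=> mn; have [_ + _] := nextP (hist n); apply; exact: t_hist.
have xiP n s : coef B (xi n) (i (x n *: t n)) <> x n.+1 * s.
  by have [_ _] := nextP (hist n); rewrite size_hist; exact.
have tail k : {l | forall n, exists N, forall m, (N <= m)%N ->
    V n (l - \sum_(j < m) q k (k + j)%N *: t (k + j)%N)}.
  apply/cid/(filt_complete cV (h := fun j => q k (k + j)%N *: t (k + j)%N)) => j.
  by apply: (filtW cV (leq_addl k j)); apply: tV; exact: leq_addr.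
pose sigma k := sval (tail k).
have sigmaE N : sigma 0%N = \sum_(j < N) q 0%N j *: t j + q 0%N N *: sigma N.
  apply/eqP; rewrite -subr_eq0; apply/eqP/(filt_sep cV) => n.
  have [m mP] := scal_cont (q 0%N N) n.+1.
  have [N1 N1P] := svalP (tail 0%N) n.+1; have [N2 N2P] := svalP (tail N) m.
  pose M := maxn N1 N2; have sumE : \sum_(j < N + M) q 0%N (0 + j)%N *: t (0 + j)%N =
      \sum_(j < N) q 0%N j *: t j + q 0%N N *: \sum_(j < M) q N (N + j)%N *: t (N + j)%N.
    rewrite big_split_ord /=; congr (_ + _); rewrite scaler_sumr.
    by apply: eq_bigr => j _; rewrite scalerA /q -big_cat_nat //= leq_addr.
  have -> : sigma 0%N - (\sum_(j < N) q 0%N j *: t j + q 0%N N *: sigma N) =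
      (sigma 0%N - \sum_(j < N + M) q 0%N (0 + j)%N *: t (0 + j)%N)
      - q 0%N N *: (sigma N - \sum_(j < M) q N (N + j)%N *: t (N + j)%N).
    by rewrite sumE scalerBr opprB !opprD !addrA subrK.
  apply: (filtB cV).
    by apply: N1P; rewrite (leq_trans (leq_maxl N1 N2)) // leq_addl.
  by apply/mP/N2P; exact: leq_maxr.
have xiE n : coef B (xi n) (i (x 0%N *: sigma 0%N)) <> 0.
  move=> e0; pose c : {linear A -> R^o} := (coef B (xi n) \o i)%FUN.
  apply: (xiP n (- c (sigma n.+1))); apply/eqP.
  rewrite mulrN -addr_eq0; apply/eqP; rewrite -[RHS]e0.
  rewrite -[RHS]/(c _) (sigmaE n.+1) scalerDr scalerA -xq linearD scaler_sumr.
  rewrite big_ord_recr linearD linear_sum big1 ?add0r => [|j _].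
    by rewrite scalerA -xq [c (x n.+1 *: _)]linearZ.
  by rewrite scalerA linearZ /= xi0 // scaler0.
have xi_inj : injective xi.
  suff H m n : (m < n)%N -> xi m <> xi n.
    by move=> m n e; case: (ltngtP m n) => // /H; rewrite e; case.
  move=> mn e; apply: (xiP m 0); rewrite mulr0 e linearZ linearZ /=.
  by rewrite xi0 // scaler0.
have [S [uS hS]] := ex_support1 B (i (x 0%N *: sigma 0%N)).
have : (size [seq (xi n : {classic J}) | n <- iota 0 (size S).+1] <= size S)%N.
  apply: uniq_leq_size; first by rewrite map_inj_uniq ?iota_uniq.
  move=> _ /mapP[n _ ->]; apply/negPn/negP => /hS; exact: xiE.
by rewrite size_map size_iota ltnn.
Qed.

End DescendingChain.
End FilteredModule.

(** * Coherence from a filtration *)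

Section Subgroup.

Definition subgroup (G : zmodType) (S : zmodClosed G) : Type := {x : G | x \in S}.

HB.instance Definition _ (G : zmodType) (S : zmodClosed G) := SubChoice.on (subgroup S).
HB.instance Definition _ (G : zmodType) (S : zmodClosed G) :=
  [SubChoice_isSubZmodule of subgroup S by <:].

Lemma ex_additive (U G : zmodType) (h : U -> G) :
  (forall x y, h (x - y) = h x - h y) ->
  exists f : {additive U -> G}, forall x, f x = h x.
Proof.
move=> lh.
pose f : {additive U -> G} := HB.pack h (GRing.isZmodMorphism.Build U G h lh).
by exists f.
Qed.

(** Like [ex_submodule], for subgroups: the solutions of a linear equation over
    a noncommutative ring only form a subgroup. *)
Lemma ex_subgroup (G : zmodType) (S : set G) :
  S 0 -> (forall x y, S x -> S y -> S (x - y)) ->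
  exists (P : zmodType) (i : {additive P -> G}),
    injective i /\ forall g, S g <-> exists p, i p = g.
Proof.
move=> S0 SB; pose S1 : {pred G} := fun x => `[< S x >].
have Sc : zmod_closed S1.
  by split=> [|x y /asboolP Sx /asboolP Sy]; apply/asboolP; [|exact: SB].
pose S' : zmodClosed G := HB.pack S1 (GRing.isZmodClosed.Build G S1 Sc).
exists (subgroup S'), (\val : {additive subgroup S' -> G}); split; first exact: val_inj.
move=> v; split=> [Sv|[p <-]]; last exact/asboolP/(valP p).
have S'v : v \in S' by exact/asboolP.
by exists (exist (fun x => x \in S') v S'v).
Qed.

Lemma filtration_sub (P G : zmodType) (W : nat -> set G) (i : {additive P -> G}) :
  complete_filtration W -> injective i ->
  (forall g : G, (forall n, exists p, W n (g - i p)) -> exists p, i p = g) ->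
  complete_filtration (fun n => [set p | W n (i p)]).
Proof.
move=> cW i_inj i_closed; split=> [n|n x|n x y|x|h Wh] /=.
- by rewrite raddf0; exact: filt0.
- by rewrite raddfN; exact: filtN.
- by rewrite raddfD; exact: filtD.
- by move=> Wx; apply: i_inj; rewrite raddf0; exact: (filt_sep cW).
have [l lE] := filt_complete cW Wh; have [|p pl] := i_closed l.
  move=> n; have [N NP] := lE n; exists (\sum_(j < N) h j).
  by rewrite raddf_sum; exact: NP.
exists p => n; have [N NP] := lE n; exists N => m Nm.
by rewrite raddfB raddf_sum pl; exact: NP.
Qed.

End Subgroup.

Section FilteredPower.
Variables (R : nzRingType) (A : lmodType R) (V : nat -> set A) (k : nat).
Hypothesis cV : complete_filtration V.
Local Notation pow := (dprod (fun _ : 'I_k => A)).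

Lemma filtration_power :
  complete_filtration (fun n => [set w : pow | forall i, V n (w i)]).
Proof.
split=> [n i|n x Vx i|n x y Vx Vy i|x Vx|h Vh] /=.
- exact: filt0.
- exact: (filtN cV (Vx i)).
- exact: (filtD cV (Vx i) (Vy i)).
- by apply: functional_extensionality_dep => i; apply: (filt_sep cV) => n; exact: Vx.
have /choice[l lE] i := filt_complete cV (fun n => Vh n i).
exists l => n; have /choice[N NP] i := lE i n.
exists (\max_i N i)%N => m Nm i.
have := NP i m (leq_trans (leq_bigmax i) Nm).
suff -> : (l - \sum_(j < m) h j : pow) i = l i - \sum_(j < m) h j i by [].
by rewrite -[LHS]/(l i - (\sum_(j < m) h j : pow) i) dprod_sumE.
Qed.

Lemma separable_power : separable_filtration V ->
  separable_filtration (fun n => [set w : pow | forall i, V n (w i)]).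
Proof.
move=> [D DP]; pose E n : pow := fun i =>
  if unpickle n is Some s then D (nth 0%N s i) else 0.
exists E => n w; have /choice[d dP] i := DP n (w i).
exists (pickle [seq d i | i <- enum 'I_k]) => i.
have e : E (pickle [seq d i | i <- enum 'I_k]) i = D (d i).
  by rewrite /E pickleK (nth_map i) ?size_enum_ord // nth_ord_enum.
by have := dP i; rewrite -e.
Qed.

End FilteredPower.

Section CoherenceFromFiltration.
Variables (R : nzRingType) (J : Type) (A : lmodType R) (B : coordinates J A).
Hypotheses (R_countable : countable [set: R]) (A_uncountable : ~ countable [set: A]).
Variable V : nat -> set A.
Hypotheses (cV : complete_filtration V) (sV : separable_filtration V).
Hypothesis scal_cont : forall (r : R) n, exists m, forall x, V m x -> V n (r *: x).

(** Suppose that the syzygies kap 0, kap 1, ... of b are not generated by the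
    first m of them, for any m.  The group P of vectors of A^n killed by b is
    the union of the images of the maps f m given by the first m syzygies,
    because A is free and supports are finite.  By Baire's theorem and the open
    mapping theorem some f m maps onto a neighbourhood of 0 in P.  For any
    syzygy v and any small x with a coordinate equal to 1, the vector of the
    v_i x is then in the image of f m, and that coordinate exhibits v as a
    combination of the first m syzygies. *)
Lemma filtered_syzygies : finite_syzygies R.
Proof.
move=> n b; apply: contrapT => no.
pose pow k := dprod (fun _ : 'I_k => A).
pose W k l := [set w : pow k | forall i, V l (w i)].
have cW k : complete_filtration (W k) by exact: filtration_power.
have [u uP] := ex_enumeration 0 R_countable.
pose kap l : 'cV[R]_n := let v := \col_i u (nth 0%N (odflt [::] (unpickle l)) i) in
  if b *m v == 0 then v else 0.
have kap0 l : b *m kap l = 0 by rewrite /kap; case: eqP => //; rewrite mulmx0.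
have kapP v : b *m v = 0 -> exists l, kap l = v.
  move=> bv; have /choice[c cE] i := uP (v i 0).
  exists (pickle [seq c i | i <- enum 'I_n]); rewrite /kap pickleK /=.
  rewrite (_ : \col_i _ = v) ?bv ?eqxx //.
  apply/colP => i; rewrite !mxE (nth_map i) ?size_enum_ord // nth_ord_enum.
  exact: cE.
pose C m : 'M[R]_(n, m) := \matrix_(i < n, l < m) kap l i 0.
have bC m : b *m C m = 0.
  apply/rowP => l; rewrite [RHS]mxE.
  transitivity ((b *m kap l) 0 0); last by rewrite kap0 mxE.
  by rewrite !mxE; apply: eq_bigr => i _; rewrite mxE.
pose syz (w : pow n) := \sum_i b 0 i *: w i.
have syzB w w' : syz (w - w') = syz w - syz w'.
  by rewrite /syz -sumrB; apply: eq_bigr => i _; rewrite -scalerBr.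
have [||P [inc [inc_inj incP]]] := @ex_subgroup (pow n) [set w | syz w = 0].
- by rewrite /mkset /syz big1 // => i _; rewrite scaler0.
- by move=> w w' /= sw sw'; rewrite syzB sw sw' subrr.
have cP : complete_filtration (fun l => [set p | W n l (inc p)]).
  apply: (filtration_sub (cW n)) => // w wlim; apply/incP/(filt_sep cV) => l.
  have [m mP] := scal_sum_cont cV scal_cont (fun i => b 0 i) l.
  have [p Wp] := wlim m; have /incP sp : exists p', inc p' = inc p by exists p.
  by rewrite -[syz w]subr0 -[X in _ - X]sp -syzB; exact: mP.
have ff m : {f : {additive pow m -> P} | forall z i,
    inc (f z) i = \sum_l C m i l *: z l}.
  apply: cid; pose g (z : pow m) : pow n := fun i => \sum_l C m i l *: z l.
  have gS z : exists p, inc p = g z.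
    apply/incP; rewrite /mkset /syz.
    under eq_bigr => i _ do rewrite scaler_sumr.
    rewrite exchange_big big1 // => l _ /=; under eq_bigr => i _ do rewrite scalerA.
    rewrite -scaler_suml; have := congr1 (fun w : 'rV[R]_m => w 0 l) (bC m).
    by rewrite /= !mxE => ->; rewrite scale0r.
  have /choice[h hE] := gS; have [|f fh] := @ex_additive _ _ h.
    move=> z z'; apply: inc_inj; rewrite raddfB !hE.
    apply: functional_extensionality_dep => i; rewrite -[RHS]sumrB.
    by apply: eq_bigr => l _; rewrite -scalerBr.
  by exists f => z i; rewrite fh hE.
pose f m := sval (ff m).
have fE m z i : inc (f m z) i = \sum_l C m i l *: z l := svalP (ff m) z i.
have f_cont m l : exists k, forall z, W m k z -> W n l (inc (f m z)).
  have /choice[k kP] i := scal_sum_cont cV scal_cont (fun j => C m i j) l.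
  exists (\max_i k i)%N => z Wz i; rewrite fE; apply: kP => j.
  by apply: (filtW cV) (Wz j); exact: (leq_bigmax i).
have f_onto p : exists m z, f m z = p.
  have /choice[l lE] j : exists l, kap l = \col_k (coef B j (inc p k) : R).
    apply: kapP; have /incP sp : exists p', inc p' = inc p by exists p.
    apply/rowP => j'; rewrite [RHS]mxE -[RHS](linear0 (coef B j)) -[X in coef B j X]sp.
    rewrite linear_sum mxE; apply: eq_bigr => k _.
    by rewrite !mxE linearZ.
  have [|s [us sy]] := @ex_support _ _ _ B [set inc p k | k in [set: 'I_n]].
    exact/finite_image/finite_finset.
  exists (\max_(j <- s) (l j).+1)%N; set m := (\max_(j <- s) _)%N.
  have [|z zE] := @free_solve _ _ _ B _ _ (C m) (inc p).
    move=> j; have [js|js] := boolP ((j : {classic J}) \in s); last first.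
      exists 0; rewrite mulmx0; apply/colP => k; rewrite !mxE.
      by apply: sy js; exists k.
    have lm : (l j < m)%N by exact: (@leq_bigmax_seq {classic J} s xpredT (fun j => (l j).+1)).
    exists (delta_mx (Ordinal lm) 0); rewrite -lE -colE.
    by apply/colP => k; rewrite !mxE.
  by exists z; apply: inc_inj; apply: functional_extensionality_dep => i; rewrite fE.
have [m [k kP]] : exists m k, forall p, W n k (inc p) -> exists z, f m z = p.
  apply: contrapT => nok.
  have /choice[E EP] m : exists E : nat -> set P, (forall x, exists j, E j (f m x)) /\
      forall j y l, exists y' m, W n l (inc (y' - y)) /\
        forall z, W n m (inc (z - y')) -> ~ E j z.
    have := @not_almost_open_meager _ _ _ _ (f m) (cW m) cP (separable_power m sV).
    apply=> ao; apply: nok; exists m.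
    exact: (open_mapping (cW m) cP (f_cont m) ao).
  pose E' j := if unpickle j is Some (m, l) then E m l else set0.
  have [|p pE] := baire cP (E := E').
    move=> j y l; rewrite /E'; case: unpickle => [[m i]|]; first by have [_] := EP m; exact.
    by exists y, l; split=> [|z _ []]; rewrite subrr; exact: (filt0 cP).
  have [m [z fz]] := f_onto p; have [cov _] := EP m; have [j Ej] := cov z.
  by apply: (pE (pickle (m, j))); rewrite /E' pickleK -fz.
apply: no; exists m, (C m); split=> // v bv0.
have [N NP] := scal_cont_fin cV scal_cont (fun i => v i 0) k.
have [j [x [Vx jx]]] := ex_small_unit B R_countable A_uncountable N cV sV.
have /incP[p pE] : syz (fun i => v i 0 *: x) = 0.
  rewrite /syz; under eq_bigr => i _ do rewrite scalerA.
  rewrite -scaler_suml; have := congr1 (fun w : 'M[R]_1 => w 0 0) bv0.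
  by rewrite /= !mxE => ->; rewrite scale0r.
have [|z fz] := kP p; first by rewrite pE => i; exact: NP.
exists (\col_l (coef B j (z l) : R)); apply/colP => i; rewrite mxE.
have := congr1 (coef B j) (congr1 (fun w : pow n => w i) pE).
rewrite -fz fE linear_sum linearZ /= jx regular_scale mulr1 => <-.
by apply: eq_bigr => l _; rewrite linearZ [in RHS]mxE.
Qed.

End CoherenceFromFiltration.

(** * Polish abelian groups are complete in their invariant uniformity *)

(** [bl n x y] stands for the distance from x to y being less than 2^-n in a
    complete metric that induces the topology but need not be invariant. *)
Section Klee.
Variables (A : zmodType) (bl : nat -> A -> A -> Prop).
Hypotheses (blxx : forall n x, bl n x x)
  (bl_triangle : forall n x y z, bl n.+1 x y -> bl n.+1 y z -> bl n x z)
  (bl_sep : forall x y, (forall n, bl n x y) -> x = y)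
  (bl_add : forall x y n, exists m, forall x' y',
    bl m x x' -> bl m y y' -> bl n (x + y) (x' + y'))
  (bl_opp : forall x n, exists m, forall x', bl m x x' -> bl n (- x) (- x'))
  (bl_complete : forall u : nat -> A, (forall n, bl n (u n) (u n.+1)) ->
    exists l, forall n, exists N, forall m, (N <= m)%N -> bl n l (u m)).

Lemma bl_le n m x y : (n <= m)%N -> bl m x y -> bl n x y.
Proof.
move=> /subnKC <-; elim: (m - n)%N => [|k IH]; rewrite ?addn0 // addnS => bxy.
by apply: IH; exact: bl_triangle (blxx _ y).
Qed.

Lemma ex_group_filtration : exists V : nat -> set A,
  [/\ forall n, V n 0, forall n x, V n x -> V n (- x),
      forall n x y, V n.+1 x -> V n.+1 y -> V n (x + y),
      forall n x, V n x -> bl n 0 x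
    & forall n, exists m, forall x, bl m 0 x -> V n x].
Proof.
have /choice[next nextP] k : exists m, forall x y, bl m 0 x -> bl m 0 y -> bl k 0 (x + y).
  by have [m mP] := bl_add 0 0 k; exists m => x y bx bY; rewrite -[X in bl k X _]addr0; exact: mP.
pose k := fix k n := if n is m.+1 then maxn n (next (k m)) else 0%N.
have kn n : (n <= k n)%N by case: n => //= n; exact: leq_maxl.
exists (fun n => [set x | bl (k n) 0 x /\ bl (k n) 0 (- x)]); split=> /=.
- by move=> n; rewrite oppr0.
- by move=> n x [? ?]; rewrite opprK.
- have kP n x : bl (k n.+1) 0 x -> bl (next (k n)) 0 x by apply: bl_le; exact: leq_maxr.
  move=> n x y [/kP x1 /kP x2] [/kP y1 /kP y2].
  by rewrite opprD; split; exact: nextP.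
- by move=> n x [+ _]; exact: bl_le.
move=> n; have [m mP] := bl_opp 0 (k n); exists (maxn (k n) m) => x bx; split.
  by apply: bl_le bx; exact: leq_maxl.
by rewrite -oppr0; apply: mP; apply: bl_le bx; exact: leq_maxr.
Qed.

(** The difficulty is that the partial sums s n of a fast series are Cauchy for
    the group uniformity only, whereas completeness is known for the metric.
    Split the series into consecutive blocks, and add the even and the odd
    blocks separately.  While one of the two sums stays put at some b, the
    index where the next block to be added to b begins can be chosen as late
    as needed to make that block small at b in the metric.  So both sums
    converge in the metric, and their limits add up to the sum of the series.
    The state (n, a, b) records that a + b = s n, that a is about to receive
    the block starting at n, and that this block will be small at a; the two
    sums are exchanged at each step. *)
Lemma klee : exists V : nat -> set A, [/\ complete_filtration V,
    forall n x, V n x -> bl n 0 x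
  & forall x n, exists m, forall y, bl m x y -> V n (y - x)].
Proof.
have [V [V0 VN VD Vbl blV]] := ex_group_filtration.
have transl x n : exists m, forall v, V m v -> bl n x (x + v).
  have [m mP] := bl_add x 0 n; exists m => v /Vbl bv.
  by rewrite -[X in bl n X _]addr0; exact: mP.
have diff x n : exists m, forall y, bl m x y -> V n (y - x).
  have [k kP] := blV n; have [m mP] := bl_add x (- x) k.
  by exists m => y bxy; apply: kP; rewrite -(subrr x); exact: mP.
have V_W n m x : (n <= m)%N -> V m x -> V n x.
  move=> /subnKC <-; elim: (m - n)%N x => [|k IH] x; rewrite ?addn0 // addnS => Vx.
  by apply: IH; rewrite -[x]addr0; exact: VD.
exists V; split=> //; split=> //; first by move=> x Vx; apply/esym/bl_sep => n; exact: Vbl.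
move=> h Vh; pose s n := \sum_(i < n) h i.
have sD n k : s (n + k)%N = s n + \sum_(i < k) h (n + i)%N by exact: big_split_ord.
have s_cauchy N n m : (N < n)%N -> (n <= m)%N -> V N (s m - s n).
  move=> Nn /subnKC <-; rewrite sD addrC addKr.
  move: (m - n)%N => k; elim: k N n Nn => [|k IH] N n Nn; first by rewrite big_ord0.
  rewrite big_ord_recl; apply: VD; first by rewrite addn0; exact: V_W (Vh n).
  under eq_bigr => i _ do rewrite /= /bump leq0n add1n addnS -addSn.
  exact: IH.
pose inv j (t : nat * A * A) := t.1.2 + t.2 = s t.1.1 /\
  forall m, (t.1.1 <= m)%N -> bl j t.1.2 (t.1.2 + (s m - s t.1.1)).
have late j b n : exists2 n', (n < n')%N & forall m, (n' <= m)%N -> bl j b (b + (s m - s n')).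
  have [N NP] := transl b j; exists (maxn n N).+1; first by rewrite ltnS leq_maxl.
  by move=> m nm; apply/NP/s_cauchy => //; rewrite ltnS leq_maxr.
have /choice[next nextP] (jt : nat * (nat * A * A)) : exists t', inv jt.1 jt.2 ->
    [/\ inv jt.1.+1 t', (jt.2.1.1 < t'.1.1)%N, t'.1.2 = jt.2.2 & bl jt.1 jt.2.1.2 t'.2].
  case: jt => j [[n a] b] /=.
  have [n' nn' n'P] := late j.+1 b n; exists (n', b, a + (s n' - s n)) => -[/= abE aP].
  split=> //; last by apply: aP; exact: ltnW.
  by split=> //=; rewrite addrA [b + a]addrC abE addrC subrK.
have [n0 _ n0P] := late 0%N 0 0%N.
pose st := fix st j := if j is i.+1 then next (i, st i) else (n0, 0, s n0).
have stP j : inv j (st j).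
  elim: j => [|j IH] /=; last by have [] := nextP (j, st j) IH.
  by split; rewrite ?add0r.
pose a j := (st j).1.2; pose n j := (st j).1.1.
have aS j : a j.+1 = (st j).2 by have [] := nextP (j, st j) (stP j).
have a2 j : bl j (a j) (a j.+2).
  by rewrite aS; have [] := nextP (j, st j) (stP j).
have nS j : (n j < n j.+1)%N by have [] := nextP (j, st j) (stP j).
have nj j : (j <= n j)%N by elim: j => // j IH; exact: leq_ltn_trans (nS j).
have aE j : a j + a j.+1 = s (n j) by rewrite aS; have [] := stP j.
have [|al alP] := bl_complete (u := fun j => a j.*2).
  by move=> j; apply: bl_le (a2 j.*2); rewrite -addnn leq_addr.
have [|be beP] := bl_complete (u := fun j => a j.*2.+1).
  by move=> j; apply: bl_le (a2 j.*2.+1); rewrite -addnn ltnW // ltnS leq_addr.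
exists (al + be) => k.
have [m1 m1P] := diff (al + be) k.+1; have [m2 m2P] := bl_add al be m1.
have [N1 N1P] := alP m2; have [N2 N2P] := beP m2.
pose j := maxn k.+2 (maxn N1 N2); exists (n j.*2) => m nm.
have jn : (j <= n j.*2)%N by apply: leq_trans (nj _); rewrite -addnn leq_addr.
rewrite -[al + be - _]opprB; apply: VN.
rewrite -(subrK (s (n j.*2)) (\sum_(i < m) h i)) -addrA; apply: VD.
  by apply: s_cauchy => //; apply: leq_trans jn; exact: leq_maxl.
apply: m1P; rewrite -aE; apply: m2P; [apply: N1P|apply: N2P].
  by rewrite /j !leq_max leqnn orbT.
by rewrite /j !leq_max leqnn !orbT.
Qed.

End Klee.

(** * From Polish topologies to filtrations *)

Section DyadicBalls.
Variables (K : realType) (X : metricType K).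

Definition dyadic n (x y : X) := ball x (2 ^- n : K) y.

Lemma exp2N_gt0 n : 0 < 2 ^- n :> K.
Proof. by rewrite invr_gt0 exprn_gt0. Qed.

Lemma exp2N_split n : 2 ^- n = 2 ^- n.+1 + 2 ^- n.+1 :> K.
Proof. by rewrite -mulr2n exprS invfM -[RHS]mulr_natl mulrA mulfV ?mul1r. Qed.

Lemma exp2N_small (e : K) : 0 < e -> exists n, 2 ^- n < e.
Proof.
move=> e0; exists (Num.bound e^-1); rewrite -[ltRHS]invrK ltf_pV2 ?posrE ?invr_gt0 ?exprn_gt0 //.
apply: lt_trans (archi_boundP _) _; first by rewrite invr_ge0 ltW.
by rewrite -natrX ltr_nat ltn_expl.
Qed.

Lemma dyadicxx n x : dyadic n x x.
Proof. exact/ballxx/exp2N_gt0. Qed.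

Lemma dyadic_triangle n x y z : dyadic n.+1 x y -> dyadic n.+1 y z -> dyadic n x z.
Proof. by move=> xy yz; rewrite /dyadic exp2N_split; exact: ball_triangle xy yz. Qed.

Lemma dyadic_sep x y : (forall n, dyadic n x y) -> x = y.
Proof.
move=> bxy; apply/eqP; rewrite -[_ == _]negbK -mdist_gt0; apply/negP => /exp2N_small[n].
by have := bxy n; rewrite /dyadic ballEmdist /= => /lt_trans /[apply]; rewrite ltxx.
Qed.

Lemma nbhs_dyadicP x (U : set X) : nbhs x U <-> exists n, dyadic n x `<=` U.
Proof.
split=> [/nbhs_ballP[e /= e0 eU]|[n nU]].
  have [n ne] := exp2N_small e0; exists n => y xy; apply: eU.
  exact: le_ball (ltW ne) _ xy.
by apply/nbhs_ballP; exists (2 ^- n) => //; exact: exp2N_gt0.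
Qed.

Lemma dyadic_complete (u : nat -> X) :
  (forall F : set_system X, ProperFilter F -> cauchy F -> exists x : X, F --> x) ->
  (forall n, dyadic n (u n) (u n.+1)) ->
  exists l, forall n, exists N, forall m, (N <= m)%N -> dyadic n l (u m).
Proof.
move=> complX uS.
have tail k N : dyadic N (u N.+1) (u (N.+1 + k)%N).
  elim: k N => [|k IH] N; first by rewrite addn0; exact: dyadicxx.
  by apply: dyadic_triangle (uS N.+1) _; rewrite addnS -addSn; exact: IH.
have [|l lE] := complX (u @ \oo) _.
  apply: cauchy_exP => e /exp2N_small[n ne]; exists (u n.+1), n.+1 => // m /= nm.
  by apply: le_ball (ltW ne) _ _; rewrite -(subnKC nm); exact: tail.
exists l => n; have /lE[N _ NP] : nbhs l (dyadic n l) by apply/nbhs_dyadicP; exists n.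
by exists N => m Nm; exact: NP.
Qed.

End DyadicBalls.

Section PolishFiltration.
Variables (K : realType) (R : nzRingType) (A : lmodType R).

Lemma polish_filtration : admits_polish_module_topology K A ->
  exists V : nat -> set A, [/\ complete_filtration V, separable_filtration V
    & forall (r : R) n, exists m, forall x, V m x -> V n (r *: x)].
Proof.
move=> [t [[D cD dD] [m [nbX complX]] addC oppC scalC]].
set T : topologicalType := Topological.Pack t in D cD dD nbX addC oppC scalC.
set X : metricType K := Metric.Pack m in nbX complX.
pose bl n (x y : A) := dyadic n (x : X) (y : X).
have nbT (x : A) (U : set A) : nbhs (x : T) U <-> exists n, bl n x `<=` U.
  by rewrite -nbX; exact: nbhs_dyadicP.
have nb_bl n (x : A) : nbhs (x : T) (bl n x) by apply/nbT; exists n.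
have bl_le n k (x y : A) : (n <= k)%N -> bl k x y -> bl n x y.
  move=> /subnKC <-; elim: (k - n)%N => [|i IH]; rewrite ?addn0 // addnS => bxy.
  by apply: IH; apply: dyadic_triangle bxy _; exact: dyadicxx.
have bl_add (x y : A) n : exists k, forall x' y',
    bl k x x' -> bl k y y' -> bl n (x + y) (x' + y').
  have [[P Q] /= [/nbT[i iP] /nbT[j jQ]] PQ] := addC (x, y) _ (nb_bl n (x + y)).
  exists (maxn i j) => x' y' xx' yy'; apply: (PQ (x', y')); split=> /=.
    by apply/iP/(bl_le i _ _ _ (leq_maxl i j)).
  by apply/jQ/(bl_le j _ _ _ (leq_maxr i j)).
have bl_opp (x : A) n : exists k, forall x', bl k x x' -> bl n (- x) (- x').
  by have /nbT[k kP] := oppC x _ (nb_bl n (- x)); exists k => x' /kP.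
have bl_scal (r : R) (x : A) n : exists k, forall x', bl k x x' -> bl n (r *: x) (r *: x').
  have [[P Q] /= [rP /nbT[k kQ]] PQ] := scalC (r, x) _ (nb_bl n (r *: x)).
  by exists k => x' /kQ Qx'; apply: (PQ (r, x')); split=> //=; exact: rP.
have [||||V [cV Vbl blV]] := @klee A bl _ _ _ bl_add bl_opp _.
- by move=> n x; exact: dyadicxx.
- by move=> n x y z; exact: dyadic_triangle.
- by move=> x y; exact: dyadic_sep.
- by move=> u; exact: dyadic_complete.
exists V; split=> //.
  have /countable_injP[num num_inj] := cD.
  have /choice[E EP] n : exists d : A, forall d', D d' -> num d' = n -> d = d'.
    have [[d [Dd dn]]|no] := pselect (exists d, D d /\ num d = n).
      by exists d => d' Dd' e; apply: num_inj; rewrite ?inE // dn e.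
    by exists 0 => d' Dd' e; case: no; exists d'.
  exists E => n x; have [k kP] := blV x n.
  have [||d [xd Dd]] := dD ((bl k x : set T)^°).
  - by exists x; exact: nb_bl.
  - exact: open_interior.
  exists (num d); rewrite (EP _ d) // -opprB.
  by apply: (filtN cV); apply: kP; exact: interior_subset xd.
move=> r n; have [k kP] := blV 0 n; have [j jP] := bl_scal r 0 k.
exists j => x /Vbl /jP; rewrite scaler0 => /kP; rewrite subr0; exact.
Qed.

End PolishFiltration.

(** * The product topology on sequences of scalars *)

Section PowerTopology.
Variables (K : realType) (R : nzRingType).
Local Notation power := (direct_power nat R^o).
Implicit Types f g h : nat -> R.

Definition agree n f g := forall i, (i < n)%N -> f i = g i.

Lemma ex_first_difference f g : f <> g -> exists n, agree n f g /\ f n <> g n.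
Proof.
move=> fg; have [|n /asboolP nP min_n] := @ex_minnP (fun n => `[< f n <> g n >]).
  apply: contrapT => no; apply: fg; apply: functional_extensionality_dep => n.
  by apply: contrapT => fgn; apply: no; exists n; exact/asboolP.
exists n; split=> // i lt_in; apply: contrapT => fgi.
by have := min_n i; rewrite leqNgt lt_in => H; have := H (asboolT fgi).
Qed.

(** The ultrametric 2^-n, for n the first place where two sequences differ. *)
Lemma ex_power_dist : exists d : (nat -> R) -> (nat -> R) -> K,
  (forall f, d f f = 0) /\
  forall n f g, agree n f g -> f n <> g n -> d f g = 2 ^- n.
Proof.
have /choice[d dP] (p : (nat -> R) * (nat -> R)) : exists e : K,
    (p.1 = p.2 -> e = 0) /\ forall n, agree n p.1 p.2 -> p.1 n <> p.2 n -> e = 2 ^- n.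
  case: p => f g /=; have [->|/ex_first_difference[n [fg fgn]]] := pselect (f = g).
    by exists 0; split=> // n _ [].
  exists (2 ^- n); split=> [e|m fg' fgm]; first by case: fgn; rewrite e.
  by case: (ltngtP n m) => [/fg'//|/fg//|->].
exists (fun f g => d (f, g)); split=> [f|n f g]; first by have [-> ] := dP (f, f).
by have [_ /(_ n)] := dP (f, g).
Qed.

Definition power_dist : power -> power -> K := sval (cid ex_power_dist).

Lemma power_distxx f : power_dist f f = 0.
Proof. by have [dff _] := svalP (cid ex_power_dist); exact: dff. Qed.

Lemma power_distE n f g : agree n f g -> f n <> g n -> power_dist f g = 2 ^- n.
Proof. by have [_ dE] := svalP (cid ex_power_dist); exact: dE. Qed.

Lemma power_dist_ge0 f g : 0 <= power_dist f g.
Proof.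
have [->|/ex_first_difference[n [fg fgn]]] := pselect (f = g); first by rewrite power_distxx.
by rewrite (power_distE fg fgn) invr_ge0 exprn_ge0.
Qed.

Lemma power_dist_agree n f g : power_dist f g < 2 ^- n <-> agree n.+1 f g.
Proof.
have [->|/ex_first_difference[m [fg fgm]]] := pselect (f = g).
  by split=> // _; rewrite power_distxx invr_gt0 exprn_gt0.
rewrite (power_distE fg fgm) ltf_pV2 ?posrE ?exprn_gt0 // ltr_eXn2l ?ltr1n //.
split=> [nm i lt_in|fgn]; first exact: fg (leq_trans lt_in nm).
by rewrite ltnNge; apply/negP => mn; exact: fgm (fgn m mn).
Qed.

Lemma power_dist_eq0 f g : power_dist f g = 0 -> f = g.
Proof.
move=> d0; apply: functional_extensionality_dep => i.
by have /power_dist_agree : power_dist f g < 2 ^- i; [rewrite d0 invr_gt0 exprn_gt0|exact].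
Qed.

Lemma power_dist_sym f g : power_dist f g = power_dist g f.
Proof.
have [->//|/ex_first_difference[n [fg fgn]]] := pselect (f = g).
rewrite (power_distE fg fgn) (@power_distE n) // => [i /fg//|e].
by apply: fgn.
Qed.

Lemma power_dist_triangle g f h : power_dist f h <= power_dist f g + power_dist g h.
Proof.
have [->|/ex_first_difference[n [fh fhn]]] := pselect (f = h).
  by rewrite power_distxx addr_ge0 ?power_dist_ge0.
rewrite (power_distE fh fhn).
have [/power_dist_agree fg|fg] := ltP (power_dist f g) (2 ^- n); last first.
  by rewrite -[leLHS]addr0 lerD ?power_dist_ge0.
have [/power_dist_agree gh|gh] := ltP (power_dist g h) (2 ^- n).
  by case: fhn; rewrite fg ?gh.
by rewrite -[leLHS]add0r lerD ?power_dist_ge0.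
Qed.

(** The limit of a Cauchy filter is the diagonal of the approximations y n: any
    two of the sets agreeing with y n and y i up to those places meet. *)
Lemma power_polish : countable [set: R] -> admits_polish_module_topology K power.
Proof.
move=> cR.
pose X : metricType K := HB.pack (GRing.Lmodule.sort power)
  (isMetric.Build K (GRing.Lmodule.sort power) power_distxx power_dist_eq0
    power_dist_sym power_dist_triangle).
have ballE n f g : dyadic n (f : X) (g : X) <-> agree n.+1 f g.
  by rewrite /dyadic ballEmdist /=; exact: power_dist_agree.
have nbX (f : X) n (U : set X) : (forall g, agree n.+1 f g -> U g) -> nbhs f U.
  by move=> fU; apply/nbhs_dyadicP; exists n => g /ballE/fU.
have nbXP (f : X) (U : set X) : nbhs f U -> exists n, forall g, agree n.+1 f g -> U g.
  by move=> /nbhs_dyadicP[n nU]; exists n => g fg; apply/nU/ballE.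
exists (Topological.class X); split.
- have [u uP] := ex_enumeration 0 cR.
  pose E n : power := fun i => if unpickle n is Some s then u (nth 0%N s i) else 0.
  exists (range E); first exact: sub_countable (card_image_le _ _) (countableP _).
  move=> U [f Uf] oU; have [n nU] := nbXP f U (open_nbhs_nbhs (conj oU Uf)).
  have /choice[c cP] i := uP (f i).
  exists (E (pickle (mkseq c n.+1))); split; last by eexists.
  by apply: nU => i lt_in; rewrite /E pickleK nth_mkseq.
- exists (Metric.class X); split=> // F PF /cauchyP cF.
  have /choice[y yP] n : exists y : X, F (dyadic n y) by apply: cF; exact: exp2N_gt0.
  exists (fun i => y i i) => U /nbXP[n nU].
  apply: filterS (yP n) => g /ballE yg; apply: nU => i lt_in.
  have [z [/ballE ynz /ballE yiz]] := @filter_ex _ _ PF _ (filterI (yP n) (yP i)).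
  by rewrite (yiz i) // -(ynz i) // yg.
- move=> [f g] U /nbXP[n nU].
  exists (agree n.+1 f, agree n.+1 g); first by split; apply: (nbX _ n).
  by move=> [f' g'] [/= ff' gg']; apply: nU => i lt_in; rewrite [LHS](congr2 _ (ff' i lt_in) (gg' i lt_in)).
- move=> f U /nbXP[n nU]; apply: (nbX _ n) => f' ff'; apply: nU => i lt_in.
  by congr (- _); exact: ff'.
move=> [r f] U /nbXP[n nU]; exists ([set r], agree n.+1 f).
  by split; [|apply: (nbX _ n)].
move=> [r' f'] [/= -> ff']; apply: nU => i lt_in.
by congr (_ * _); exact: ff'.
Qed.

End PowerTopology.

(** * The equivalence *)

Section Implications.
Variables (K : realType) (R : nzRingType) (R_countable : countable [set: R]).
Local Notation power := (direct_power nat R^o).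

Lemma power_uncountable : ~ countable [set: power].
Proof.
move=> /(ex_enumeration 0)[u uP].
have [n un] := uP (fun n => (u n n == 0)%:R).
have := congr1 (fun f : power => f n) un; case: eqP => [-> /eqP|nz /= e]; last exact: nz.
by rewrite eq_sym oner_eq0.
Qed.

Lemma regular_projective : projective R^o.
Proof.
move=> M N g f gs; have [m _ gm] := gs (f 1) I.
have [|h hE] := @ex_linear R R^o M (fun a => a *: m).
  by move=> a x y; rewrite scalerDl scalerA.
by exists h => x; rewrite hE linearZ gm -linearZ regular_scale mulr1.
Qed.

(** A diagonal argument: at place k the sequence x is 0 or 1 so that
    p x_k - (C k)_k is outside q R; if p - (C k)_k and - (C k)_k were both in
    q R, so would be p. *)
Lemma power_large (p q : R) (C : nat -> power) :
  (forall s, p <> q * s) -> exists x, forall k y, p *: x - C k <> q *: y.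
Proof.
move=> pq; pose x : power := fun n => (~~ `[< exists s, p - C n n = q * s >])%:R.
exists x => n y /(congr1 (fun f : power => f n)); rewrite -[LHS]/(p * x n - C n n).
rewrite /x -[RHS]/(q * y n); case: asboolP => [[s es]|no].
  rewrite mulr0 sub0r => ey; apply: (pq (s - y n)).
  by rewrite mulrBr -es -ey opprK subrK.
by rewrite mulr1 => ey; apply: no; exists (y n).
Qed.

Lemma power_projective_right_dcc : projective power -> right_dcc R.
Proof.
move=> pP; have [J [F [B [i [r ri]]]]] := ex_free_retract pP.
have [V [cV sV scalV]] := polish_filtration (power_polish K R_countable).
exact: (filtered_right_dcc R_countable cV sV scalV B ri power_large).
Qed.

Lemma polish_free_coherent_perfect (A : lmodType R) :
  free_module A -> ~ countable [set: A] -> admits_polish_module_topology K A ->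
  right_coherent R /\ left_perfect R.
Proof.
move=> [J [f bf]] uA polA; have [B] := iso_coordinates (copower_coordinates R J) bf.
have [V [cV sV scalV]] := polish_filtration polA; split.
  exact/syzygies_coherent/(filtered_syzygies B R_countable uA cV sV scalV).
apply: right_dcc_left_perfect.
apply: (filtered_right_dcc R_countable cV sV scalV B (i := idfun) (r := idfun)) => //.
exact: (free_large B R_countable uA).
Qed.

End Implications.

Theorem theorem1p4 (K : realType) (R : nzRingType) (R_countable : countable [set: R]) :
  [<-> exists A : lmodType R,
         [/\ free_module A, ~ countable [set: A]
           & admits_polish_module_topology K A];
       right_coherent R /\ left_perfect R;
       forall (I : Type) (M : I -> lmodType R),
         (forall i, projective (M i)) -> projective (dprod M);
       isomorphic (direct_power nat R^o) (direct_copower (nat -> bool) R^o)].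
Proof.
tfae.
- by move=> [A [freeA uncA polA]]; exact: polish_free_coherent_perfect polA.
- by move=> [cohR perfR] I M; exact: dprod_projective.
- move=> prodR.
  have pP : projective (direct_power nat R^o).
    by apply: prodR => _; exact: regular_projective.
  apply: power_free => //; apply: right_dcc_left_perfect.
  exact: (power_projective_right_dcc K R_countable pP).
move=> iso; exists (direct_power nat R^o); split.
- by exists (nat -> bool).
- exact: power_uncountable.
- exact: power_polish.
Qed.
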